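(* Let $q\ge 3$ be an integer and let $\phi$ denote the Euler totient function. Then $(\phi(n)\bmod q)_{n=1}^\infty$ is not a bracket word.
   Context: $\mathbb N=\{1,2,\dots\}$, $\mathbb N_0=\mathbb N\cup\{0\}$. $\phi(n)=|(\mathbb Z/n\mathbb Z)^*|$ for $n\in\mathbb N$. Generalised polynomial (GP) maps $\mathbb R\to\mathbb R$ form the smallest family of maps that contains all polynomial maps $\mathbb R\to\mathbb R$ (with real coefficients), is closed under sums and products, and contains $\lfloor g\rfloor$ whenever it contains $g$. A GP map on $\Omega\subset\mathbb R$ is the restriction to $\Omega$ of such a map. A bracket word over a finite alphabet $\Sigma$ is an infinite word $\mathbf a=(a_n)_{n=0}^\infty\in\Sigma^\infty$ of the form $a_n=c(g(n))$ for all $n\in\mathbb N_0$, where $g\colon\mathbb N_0\to\mathbb R$ is a finitely-valued GP map and $c\colon g(\mathbb N_0)\to\Sigma$ is an arbitrary map. For a word $(a_n)_{n=1}^\infty$ indexed from $1$, being a bracket word means the same with $\mathbb N_0$ replaced by $\mathbb N$ (equivalently, the shifted word $(a_{n+1})_{n=0}^\infty$ is a bracket word). *)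

(* Defs.v *)
From HB Require Import structures.
From mathcomp Require Import all_boot all_order all_algebra.
From mathcomp Require Import all_classical all_reals.

Set Implicit Arguments.
Unset Strict Implicit.
Unset Printing Implicit Defensive.

Import Order.TTheory GRing.Theory Num.Theory.
Local Open Scope classical_set_scope.
Local Open Scope ring_scope.

Inductive gp_map (R : realType) : (R -> R) -> Prop :=
| gp_poly (p : {poly R}) : gp_map (fun x => p.[x])
| gp_add (f g : R -> R) : gp_map f -> gp_map g -> gp_map (fun x => f x + g x)
| gp_mul (f g : R -> R) : gp_map f -> gp_map g -> gp_map (fun x => f x * g x)
| gp_floor (g : R -> R) : gp_map g -> gp_map (fun x => (Num.floor (g x))%:~R).

Definition gp_map_on (R : realType) (D : set nat) (g : nat -> R) : Prop :=
  exists2 f : R -> R, gp_map f & forall n, D n -> g n = f n%:R.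

(* A word indexed by D is a function on nat of which only the values on D are
   relevant.  The coding c is only used on g @` D; letting it be defined on all
   of R is harmless, since any map g @` D -> Sigma extends to R. *)
Definition bracket_word (R : realType) (Sigma : finType) (D : set nat)
    (a : nat -> Sigma) : Prop :=
  exists (g : nat -> R) (c : R -> Sigma),
    [/\ gp_map_on D g, finite_set (g @` D) & forall n, D n -> a n = c (g n)].
Arguments bracket_word R {Sigma} D a.

(* Main.v *)
Require Import Defs.
From HB Require Import structures.
From mathcomp Require Import all_boot all_order all_algebra.
From mathcomp Require Import all_classical all_reals.
From mathcomp Require Import zify ring lra.
From mathcomp Require Import finset.

Set Implicit Arguments.
Unset Strict Implicit.
Unset Printing Implicit Defensive.

Import Order.TTheory GRing.Theory Num.Theory.

(** Sample a bracket word along the progressions x + y m with 0 <= m <= N, for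
    all x >= 1 and y >= 0.  The words of length N + 1 seen in this way number at
    most (N + 2)^C, where C depends on the word only ([bracket_complexity]).
    Indeed a generalised polynomial in x + y m is, once x and y are sorted into
    polynomially many types, a linear combination with real coefficients
    c_j(x, y) of a fixed number of integer-valued functions of m which depend
    on the type only and have polynomial size.  Sums and products preserve this
    form.  So do integer parts: splitting c_j into integer and fractional part
    reduces the matter to bounded coefficients, and then the integer part is
    read off from the position of the coefficient vector with respect to
    polynomially many half-spaces, for which the Sauer-Shelah lemma leaves
    polynomially many possibilities ([tame_floor]).

    For the totient function this bound fails.  As q >= 3, either an odd prime r
    divides q or 4 does, and one may reduce modulo r or modulo 4.  Both cases
    need many primes p which are not 1 modulo d (d = r or 4).  These are not too
    rare, by a variant of Euclid's argument: if the sum of their reciprocals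
    converged, a sieve by these primes would leave some n = -1 modulo d without
    any prime factor of this kind, although such a factor must exist
    ([many_primes_ne1]).

    Modulo an odd prime r, take a set S of primes up to N + 1 that are neither 0
    nor 1 modulo r and let x be their product.  Then phi(x p) is phi(x) p or
    phi(x) (p - 1) according as p belongs to S or not, and phi(x) is a unit
    modulo r.  So the values phi(x + x m), m <= N, determine S, and the number of
    words is exponential in the number of primes
    ([totient_mod_odd_prime]).

    Modulo 4, phi(n) = 2 essentially means that n is a power of a prime p = 3
    modulo 4 or twice such a power.  Consider the windows of length N + 1
    starting below X = 2^I, with N of order I^2.  On average they contain many
    primes that are 3 modulo 4, so a proportion at least 1/(2 I^2) of them
    contains k such primes.  If there were only N^C words, one of them would
    occur in a proportion I^(-O(C)) of all windows, and this would prescribe k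
    fixed positions where phi takes the value 2 modulo 4.  Brun's sieve bounds
    this proportion by I^(-ck) with an absolute c > 0 ([sieve_upper_bound]),
    which is a contradiction for k large compared to C ([totient_mod4]). *)

(** * The Sauer-Shelah lemma *)

Local Open Scope nat_scope.

Definition shatters (T : finType) (F : {set {set T}}) (S : {set T}) :=
  [forall (B : {set T} | B \subset S), exists A in F, S :&: A == B].

Lemma shattersP (T : finType) (F : {set {set T}}) (S : {set T}) :
  reflect (forall B : {set T}, B \subset S -> exists2 A, A \in F & S :&: A = B)
          (shatters F S).
Proof.
apply: (iffP forall_inP) => [h B /h /exists_inP [A AF /eqP e]|h B /h [A AF e]].
  by exists A.
by apply/exists_inP; exists A => //; apply/eqP.
Qed.

(** Pajor's form of the Sauer-Shelah lemma.  Split F by an element x on which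
    two members disagree.  A set shattered by both halves is shattered by F with
    or without x added, so the two families of shattered sets, of which none
    contains x, inject together into the sets shattered by F. *)
Lemma card_le_shattered (T : finType) (F : {set {set T}}) :
  #|F| <= #|[set S | shatters F S]|.
Proof.
have [n] := ubnP #|F|; elim: n F => // n IH F /ltnSE leFn.
have [F1|] := leqP #|F| 1.
  (* A nonempty family shatters the empty set. *)
  have [->|[A AF]] := set_0Vmem F; first by rewrite cards0.
  apply: leq_trans F1 _; apply/card_gt0P; exists set0; rewrite inE.
  apply/shattersP => B; rewrite subset0 => /eqP ->.
  by exists A => //; rewrite set0I.
move=> /card_gt1P [A [B [AF BF nAB]]].
have [x xAB] : exists x, (x \in A) != (x \in B).
  apply/existsP; rewrite -negb_forall; apply: contraNN nAB => /forallP h.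
  by apply/eqP/setP => x; apply/eqP/h.
pose F1 := [set A in F | x \in A]; pose F0 := [set A in F | x \notin A].
have cF : #|F| = #|F0| + #|F1|.
  rewrite -(cardsID [set A : {set T} | x \in A] F) addnC; congr (_ + _).
    by apply: eq_card => C; rewrite !inE andbC.
  by apply: eq_card => C; rewrite !inE.
have [c0 c1] : 0 < #|F0| /\ 0 < #|F1|.
  split; apply/card_gt0P.
    by move: xAB; case xA: (x \in A); case xB: (x \in B) => // _;
      [exists B | exists A]; rewrite !inE ?AF ?BF ?xA ?xB.
  by move: xAB; case xA: (x \in A); case xB: (x \in B) => // _;
      [exists A | exists B]; rewrite !inE ?AF ?BF ?xA ?xB.
set sh := [set S | _]; pose sh0 := [set S | shatters F0 S].
pose sh1 := [set S | shatters F1 S].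
have x0 S : S \in sh0 -> x \notin S.
  rewrite inE => /shattersP /(_ S (subxx _)) [C]; rewrite inE => /andP[_ xC] e.
  by apply: contra xC => xS; move: xS; rewrite -{1}e inE => /andP[].
have x1 S : S \in sh1 -> x \notin S.
  rewrite inE => /shattersP /(_ set0 (sub0set _)) [C]; rewrite inE => /andP[_ xC] e.
  by apply/negP => xS; move/setP/(_ x): e; rewrite !inE xS xC.
have sub0 : sh0 :|: sh1 \subset sh.
  apply/fintype.subsetP => S; rewrite !inE => /orP[]/shattersP h;
   by apply/shattersP => D /h [C]; rewrite inE => /andP[CF _] e; exists C.
pose shx := [set x |: S | S in sh0 :&: sh1].
have sub1 : shx \subset sh.
  apply/fintype.subsetP => U /imsetP[S]; rewrite inE => /andP[S0 S1] -> {U}.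
  have xS := x0 _ S0.
  move: S0 S1; rewrite !inE => /shattersP h0 /shattersP h1.
  apply/shattersP => D sD; have sDS : D :\ x \subset S by rewrite subDset.
  case xD: (x \in D); [have [C] := h1 _ sDS | have [C] := h0 _ sDS];
    rewrite inE => /andP[CF xC] e; exists C => //; apply/setP => y;
    move/setP/(_ y): e; rewrite !inE; have [->|//] := eqVneq y x.
    by rewrite xC xD.
  by rewrite (negbTE xC) xD (negbTE xS).
have dis : [disjoint sh0 :|: sh1 & shx].
  rewrite -setI_eq0; apply/eqP/setP => S; rewrite [in RHS]inE; apply/negP.
  rewrite inE => /andP[S01 /imsetP[S' _ e]]; have: x \notin S.
    by move: S01; rewrite inE => /orP[/x0|/x1].
  by rewrite e !inE eqxx.
have cx : #|shx| = #|sh0 :&: sh1|.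
  apply: card_in_imset => S S' ; rewrite !in_setI => /andP[/x0 n1 _] /andP[/x0 n' _] e.
  by rewrite -(setU1K n1) e setU1K.
rewrite cF; apply: leq_trans (leq_add (IH F0 _) (IH F1 _)) _.
- by rewrite (leq_trans _ leFn) // cF -[X in X < _]addn0 ltn_add2l.
- by rewrite (leq_trans _ leFn) // cF -[X in X < _]add0n ltn_add2r.
rewrite -/sh0 -/sh1 -cardsUI -cx -cardsUI.
move: dis; rewrite -setI_eq0 => /eqP ->; rewrite cards0 addn0.
by apply: subset_leq_card; rewrite subUset sub0 sub1.
Qed.

Lemma card_small_sets (T : finType) (d : nat) :
  #|[set S : {set T} | #|S| <= d]| <= #|T|.+1 ^ d.
Proof.
pose f (g : {ffun 'I_d -> option T}) : {set T} := [set x | [exists i, g i == Some x]].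
rewrite -card_option -[d in X in _ <= X](card_ord d) -card_ffun -cardsT.
apply: leq_trans (leq_imset_card f _).
apply: subset_leq_card; apply/fintype.subsetP => S; rewrite inE => Sd.
apply/imsetP; exists [ffun i : 'I_d => nth None (map Some (enum S)) i] => //.
apply/setP => x; rewrite inE; apply/idP/existsP => [xS|[i]].
  have lt : index x (enum S) < #|S| by rewrite cardE index_mem mem_enum.
  exists (Ordinal (leq_trans lt Sd)); rewrite ffunE /= (nth_map x) -?cardE //.
  by rewrite nth_index // mem_enum.
rewrite ffunE; have [lt|ge] := ltnP i #|S|; last first.
  by rewrite nth_default // size_map -cardE.
rewrite (nth_map x) -?cardE // => /eqP[<-].
by rewrite -mem_enum mem_nth // -cardE.
Qed.

Lemma sauer_shelah (T : finType) (F : {set {set T}}) (d : nat) :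
  (forall S, shatters F S -> #|S| <= d) -> #|F| <= #|T|.+1 ^ d.
Proof.
move=> h; apply: leq_trans (card_le_shattered F) (leq_trans _ (card_small_sets T d)).
by apply: subset_leq_card; apply/fintype.subsetP => S; rewrite !inE => /h.
Qed.

(** * Patterns cut out by half-spaces *)

Local Open Scope ring_scope.

(** More vectors than coordinates: the left kernel of the matrix is nonzero. *)
Lemma linear_dependency (F : fieldType) (I J : finType) (u : I -> J -> F) :
  (#|J| < #|I|)%N ->
  exists l : I -> F, (exists i, l i != 0) /\ forall j, \sum_i l i * u i j = 0.
Proof.
move=> lt; pose A : 'M_(#|I|, #|J|) := \matrix_(i, j) u (enum_val i) (enum_val j).
have : kermx A != 0.
  by rewrite -mxrank_eq0 mxrank_ker subn_eq0 -ltnNge (leq_ltn_trans (rank_leq_col A)).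
case/rowV0Pn => r /sub_kermxP rA /rV0Pn [i ri].
exists (fun i => r 0 (enum_rank i)); split; first by exists (enum_val i); rewrite enum_valK.
move=> j; have /matrixP /(_ 0 (enum_rank j)) := rA; rewrite !mxE => e; rewrite -[RHS]e.
rewrite (reindex (@enum_val I I)) /=; last by apply: onW_bij; apply: enum_val_bij.
by apply: eq_bigr => k _; rewrite !mxE enum_valK enum_rankK.
Qed.

(** If more than #|J| + 1 of the inequalities could be decided independently,
    the vectors (v e, theta e) would satisfy a linear relation with a positive
    coefficient.  Asking an inequality to hold exactly where its coefficient in
    the relation is <= 0 makes every term of the relation <= 0 and one term
    negative, which is absurd. *)
Lemma halfspace_shatter (R : realFieldType) (X : Type) (E J : finType)
  (c : X -> J -> R) (v : E -> J -> R) (theta : E -> R) (S : {set E}) :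
  (forall B : {set E}, B \subset S -> exists x, forall e, e \in S ->
      (theta e <= \sum_j c x j * v e j) = (e \in B)) ->
  (#|S| <= #|J|.+1)%N.
Proof.
move=> h; rewrite leqNgt; apply/negP => lt.
pose I : finType := {e | e \in S}.
pose u (i : I) (j : option J) := if j is Some j then v (val i) j else theta (val i).
have [|l [[i0 li0] lu]] := @linear_dependency _ I (option J) u.
  by rewrite card_option card_sig; rewrite (eq_card (B := mem S)).
wlog l0 : l i0 li0 lu / 0 < l i0 => [hw|].
  have [|le|e] := ltgtP 0 (l i0); [exact: hw| |by rewrite -e eqxx in li0].
  apply: (hw (fun i => - l i) i0); rewrite ?oppr_eq0 ?oppr_gt0 // => j.
  by under eq_bigr do rewrite mulNr; rewrite sumrN lu oppr0.
have [|x hx] := h [set val i | i : I & l i <= 0].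
  by apply/fintype.subsetP => _ /imsetP [i _ ->]; apply: (valP i).
have hxi i : (theta (val i) <= \sum_j c x j * v (val i) j) = (l i <= 0).
  by rewrite (hx _ (valP i)) mem_imset ?inE //; apply: val_inj.
have : \sum_i l i * (\sum_j c x j * v (val i) j - theta (val i)) = 0.
  under eq_bigr do rewrite mulrBr mulr_sumr.
  rewrite sumrB (lu None) subr0 exchange_big /= big1 // => j _.
  by under eq_bigr do rewrite mulrCA; rewrite -mulr_sumr (lu (Some j)) mulr0.
apply/eqP; rewrite lt_eqF // (bigD1 i0) //= ltr_wnDr //.
  apply: sumr_le0 => i _; have := hxi i; case: (ltP 0 (l i)) => li.
    by move/negbT; rewrite -ltNge => f; rewrite mulr_ge0_le0 ?ltW // subr_lt0.
  by move=> f; rewrite mulr_le0_ge0 // subr_ge0.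
by rewrite pmulr_rlt0 // subr_lt0 ltNge hxi -ltNge.
Qed.

(** The pattern of inequalities satisfied by x takes polynomially many values in
    the number #|E| of half-spaces when the dimension #|J| is fixed; k labels
    the pattern. *)
Lemma halfspace_classes (R : realFieldType) (X : Type) (E J : finType)
  (c : X -> J -> R) (v : E -> J -> R) (theta : E -> R) :
  exists k : X -> 'I_(#|E|.+1 ^ #|J|.+1), forall x y, k x = k y -> forall e,
    (theta e <= \sum_j c x j * v e j) = (theta e <= \sum_j c y j * v e j).
Proof.
pose Sx x := [set e | theta e <= \sum_j c x j * v e j].
pose F := [set S | `[< exists x, S = Sx x >]].
have Fx x : Sx x \in F by rewrite inE; apply/asboolP; exists x.
have cF : (#|F| <= #|E|.+1 ^ #|J|.+1)%N.
  apply: sauer_shelah => S /shattersP sh.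
  apply: (@halfspace_shatter _ X _ _ c v theta) => B /sh [A].
  rewrite inE => /asboolP [x ->] <-; exists x => e eS.
  by rewrite !inE eS.
have lt x : (index (Sx x) (enum F) < #|E|.+1 ^ #|J|.+1)%N.
  by rewrite (leq_trans _ cF) // cardE index_mem mem_enum.
exists (fun x => Ordinal (lt x)) => x y [] exy e.
have /setP/(_ e) : Sx x = Sx y.
  by rewrite -(nth_index finset.set0 (s := enum F) (x := Sx x)) ?mem_enum // exy nth_index ?mem_enum.
by rewrite !inE.
Qed.

(** * Sampling a generalised polynomial along progressions *)

Local Open Scope ring_scope.

(** The type tau x captures all that depends on x in a combinatorial way; the
    remaining dependence on x is through the real coefficients c x j, which are
    arbitrary.  The number of terms #|J| and the exponent C do not depend on the
    window length N.  Using N + 2 >= 2 as the base lets a larger exponent absorb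
    constant factors. *)
Definition tame (R : realType) (X : Type) (h : X -> nat -> R) : Prop :=
  exists (J : finType) (C : nat), forall N : nat,
  exists (K : finType) (tau : X -> K) (c : X -> J -> R) (w : K -> J -> nat -> int),
    [/\ (#|K| <= N.+2 ^ C)%N,
        forall t j m, (m <= N)%N -> (`|w t j m|%N <= N.+2 ^ C)%N
      & forall x m, (m <= N)%N -> h x m = \sum_j c x j * (w (tau x) j m)%:~R].

Lemma tame_fst (R : realType) (X : Type) (f : X -> R) : tame (fun x _ => f x).
Proof.
exists unit, 0%N => N; exists unit, (fun=> tt), (fun x _ => f x), (fun _ _ _ => 1%:Z).
split=> [|//|x m _]; first by rewrite card_unit.
by rewrite (big_pred1 tt) ?mulr1 // => -[].
Qed.

Lemma tame_snd (R : realType) (X : Type) : tame (fun (x : X) m => m%:R : R).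
Proof.
exists unit, 1%N => N; exists unit, (fun=> tt), (fun _ _ => 1), (fun _ _ m => m%:Z).
split=> [|t j m mN|x m _]; first by rewrite card_unit expn1.
  by rewrite expn1 absz_nat ltnW // ltnW.
by rewrite (big_pred1 tt) ?mul1r // => -[].
Qed.

Lemma tame_add (R : realType) (X : Type) (f g : X -> nat -> R) :
  tame f -> tame g -> tame (fun x m => f x m + g x m).
Proof.
move=> [J [C hf]] [J' [C' hg]]; exists (J + J')%type, (C + C')%N => N.
have [K [tau [c [w [cK wb hw]]]]] := hf N.
have [K' [tau' [c' [w' [cK' wb' hw']]]]] := hg N.
exists (K * K')%type, (fun x => (tau x, tau' x)),
  (fun x j => match j with inl j => c x j | inr j => c' x j end),
  (fun t j m => match j with inl j => w t.1 j m | inr j => w' t.2 j m end).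
split=> [|t [] j m mN|x m mN].
- by rewrite card_prod expnD leq_mul.
- by rewrite (leq_trans (wb _ _ _ mN)) // leq_exp2l // leq_addr.
- by rewrite (leq_trans (wb' _ _ _ mN)) // leq_exp2l // leq_addl.
- by rewrite big_sumType /= -hw // -hw'.
Qed.

Lemma tame_mul (R : realType) (X : Type) (f g : X -> nat -> R) :
  tame f -> tame g -> tame (fun x m => f x m * g x m).
Proof.
move=> [J [C hf]] [J' [C' hg]]; exists (J * J')%type, (C + C')%N => N.
have [K [tau [c [w [cK wb hw]]]]] := hf N.
have [K' [tau' [c' [w' [cK' wb' hw']]]]] := hg N.
exists (K * K')%type, (fun x => (tau x, tau' x)),
  (fun x j => c x j.1 * c' x j.2), (fun t j m => w t.1 j.1 m * w' t.2 j.2 m).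
split=> [|t j m mN|x m mN].
- by rewrite card_prod expnD leq_mul.
- by rewrite abszM expnD leq_mul ?wb ?wb'.
- rewrite hw // hw' // big_distrlr /= pair_bigA /=.
  by apply: eq_bigr => j _; rewrite intrM mulrACA.
Qed.

Lemma eq_tame (R : realType) (X : Type) (f g : X -> nat -> R) :
  (forall x m, f x m = g x m) -> tame f -> tame g.
Proof.
move=> e [J [C h]]; exists J, C => N; have [K [tau [c [w [? ? hw]]]]] := h N.
by exists K, tau, c, w; split=> // x m mN; rewrite -e hw.
Qed.

Lemma tame_poly (R : realType) (X : Type) (u : X -> nat -> R) (p : {poly R}) :
  tame u -> tame (fun x m => p.[u x m]).
Proof.
move=> tu; elim/poly_ind: p => [|p a IH].
  by apply: eq_tame (@tame_fst R X (fun=> 0)) => x m; rewrite horner0.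
apply: eq_tame (tame_add (tame_mul IH tu) (@tame_fst R X (fun=> a))) => x m.
by rewrite hornerMXaddC.
Qed.

(** Absorbs a constant factor n into the exponent. *)
Lemma leq_exp_self n N : (n <= N.+2 ^ n)%N.
Proof. by apply: ltnW; apply: ltn_expl. Qed.

Lemma leq_grid_exp (a b N C : nat) : (a <= N.+1)%N -> (b <= N.+2 ^ C)%N ->
  ((a * b).+1 <= N.+2 ^ C.+1)%N.
Proof.
move=> ha hb; rewrite expnS; apply: (@leq_trans (N.+1 * N.+2 ^ C).+1).
  by rewrite ltnS leq_mul.
by rewrite [X in (_ <= X)%N]mulSn -addn1 addnC leq_add2r expn_gt0.
Qed.

(** Write c x j = z_j + y_j with z_j an integer and 0 <= y_j < 1.  As the w j m are
    integers, the floor of the sum of the c x j * w j m is the sum of the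
    z_j * w j m plus the floor of the sum of the y_j * w j m.  The latter is an
    integer of polynomial size, so as a function of m it is determined by
    polynomially many inequalities between the y_j.  It becomes an additional
    function w, with coefficient 1, once the type has been refined by the pattern
    of these inequalities. *)
Lemma tame_floor (R : realType) (X : Type) (g : X -> nat -> R) :
  tame g -> tame (fun x m => (Num.floor (g x m))%:~R : R).
Proof.
move=> [J [C hg]].
pose D := (C + #|J|)%N.
exists (option J), (C + D.+3 * #|J|.+1)%N => N.
have [K [tau [c [w [cK wb hw]]]]] := hg N.
pose B := (N.+2 ^ D)%N.
pose fr x j := c x j - (Num.floor (c x j))%:~R.
pose s t x m : R := \sum_j fr x j * (w t j m)%:~R.
have fr01 x j : 0 <= fr x j <= 1.
  have /andP[h1 h2] := floor_itv (c x j).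
  by rewrite /fr; move: h2; rewrite intrD => h2; apply/andP; split; lra.
have sB t x m : (m <= N)%N -> `|s t x m| <= B%:R.
  move=> mN; apply: le_trans (ler_norm_sum _ _ _) _.
  apply: (@le_trans _ _ (\sum_(j : J) (N.+2 ^ C)%:R)).
    apply: ler_sum => j _; have /andP[h0 h1] := fr01 x j.
    rewrite normrM ger0_norm // -intr_norm -abszE.
    apply: le_trans (ler_wpM2r _ h1) _; first by rewrite ler0n.
    by rewrite mul1r pmulrn ler_nat wb.
  rewrite sumr_const -mulrnA ler_nat /B /D expnD leq_mul2l.
  by rewrite leq_exp_self orbT.
(* The integer thresholds between -B and B, shifted by B. *)
pose E : finType := ('I_N.+1 * 'I_(2 * B).+1)%type.
have hk t := @halfspace_classes R X E J fr
   (fun e j => (w t j e.1)%:~R) (fun e => e.2%:R - B%:R).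
have [k {}hk] := choice hk.
have fl t x y m : (m <= N)%N -> k t x = k t y ->
    (Num.floor (s t x m) <= Num.floor (s t y m)).
  move=> mN kxy; set l := Num.floor (s t x m).
  have lle : l%:~R <= s t x m by rewrite floor_le.
  have lgt : s t x m < (l + 1)%:~R by rewrite floorD1_gt.
  have /ler_normlP [b1 b2] := sB t x m mN.
  have lB : - (B%:Z) <= l.
    have : (- B%:Z - 1 < l); last by lia.
    rewrite -(ltr_int R); move: lgt; rewrite !intrD intrN /= -pmulrn => lgt.
    lra.
  have lB' : l <= B%:Z by rewrite -(ler_int R) -pmulrn; lra.
  have lt : (absz (l + B%:Z)%R < (2 * B).+1)%N by lia.
  have := hk t x y kxy (Ordinal (n := N.+1) mN, Ordinal lt) => /=.
  have -> : (absz (l + B%:Z)%R)%:R - B%:R = l%:~R :> R.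
    rewrite pmulrn gez0_abs; last by lia.
    by rewrite intrD -pmulrn addrK.
  by rewrite -[X in X = _]/(l%:~R <= s t x m) lle floor_ge_int => <-.
pose tau' x : K * 'I_(#|E|.+1 ^ #|J|.+1) := (tau x, k (tau x) x).
(* The new function is computed from an arbitrary representative of the class. *)
pose w' (t : K * 'I_(#|E|.+1 ^ #|J|.+1)) (j : option J) (m : nat) : int :=
  match j with
  | Some j => w t.1 j m
  | None => if pselect (exists x, k t.1 x = t.2) is left ex
            then Num.floor (s t.1 (projT1 (cid ex)) m) else 0
  end.
exists _, tau', (fun x j => if j is Some j then (Num.floor (c x j))%:~R else 1), w'.
have hE : (#|E|.+1 <= N.+2 ^ D.+3)%N.
  rewrite card_prod !card_ord; apply: leq_grid_exp => //.
  have : (0 < B)%N by rewrite expn_gt0.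
  rewrite !expnS -/B; nia.
have hL : (#|E|.+1 ^ #|J|.+1 <= N.+2 ^ (D.+3 * #|J|.+1))%N.
  by rewrite expnM leq_exp2r.
split=> [|t [j|] m mN|x m mN].
- by rewrite card_prod card_ord expnD leq_mul.
- by rewrite (leq_trans (wb _ _ _ mN)) // leq_exp2l // leq_addr.
- rewrite /w'; case: pselect => [ex|_]; last by rewrite absz0.
  apply: (@leq_trans B); last first.
    by rewrite leq_exp2l // /D; nia.
  have /ler_normlP [b1 b2] := sB t.1 (projT1 (cid ex)) m mN.
  set z := s _ _ _ in b1 b2 *.
  have h1 : (Num.floor z <= B%:Z) by rewrite -(ler_int R) -pmulrn (le_trans (floor_le _)).
  have h2 : (- B%:Z <= Num.floor z) by rewrite floor_ge_int intrN -pmulrn; lra.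
  by lia.
- rewrite (bigD1 None) //= mul1r {1}/w'; case: pselect => [ex|[]]; last by exists x.
  have ke := projT2 (cid ex); set y := projT1 _ in ke *.
  have -> : Num.floor (s (tau x) y m) = Num.floor (s (tau x) x m).
    by apply/eqP; rewrite eq_le !fl.
  rewrite (reindex_omap Some id) /=; last by case.
  rewrite (eq_bigl xpredT) => [|j]; last by rewrite /= eqxx.
  pose z := \sum_j Num.floor (c x j) * w (tau x) j m.
  have -> : g x m = z%:~R + s (tau x) x m.
    rewrite hw // /z /s [(\sum_j _)%:~R]raddf_sum -big_split /=.
    by apply: eq_bigr => j _; rewrite /fr intrM -mulrDl addrC subrK.
  rewrite floorDzr ?intr_int // intrKfloor intrD addrC.
  by congr (_ + _); rewrite /z raddf_sum; apply: eq_bigr => j _; rewrite /= intrM.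
Qed.

Lemma tame_gp (R : realType) (X : Type) (u : X -> nat -> R) (f : R -> R) :
  gp_map f -> tame u -> tame (fun x m => f (u x m)).
Proof.
move=> gf tu; elim: gf => [p|f1 f2 _ h1 _ h2|f1 f2 _ h1 _ h2|f1 _ h].
- exact: tame_poly.
- exact: tame_add.
- exact: tame_mul.
- exact: tame_floor.
Qed.

(** The label k x need not determine the starting point x.1 and the step x.2 of a
    progression, only the word read along its first N + 1 terms. *)
Definition poly_complexity (T : Type) (a : nat -> T) : Prop :=
  exists C : nat, forall N : nat, exists (K : finType) (k : nat * nat -> K),
    (#|K| <= N.+2 ^ C)%N /\
    forall x y : nat * nat, (0 < x.1)%N -> (0 < y.1)%N -> k x = k y ->
      forall m, (m <= N)%N -> a (x.1 + x.2 * m)%N = a (y.1 + y.2 * m)%N.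

(** A bracket word is recovered from its generalised polynomial g by a map that
    need not have any structure, so the value of g itself has to be determined by
    the class.  As g has finitely many values s_i, it suffices to know for which
    m and i the inequality s_i <= g holds. *)
Lemma bracket_complexity (R : realType) (Sigma : finType) (a : nat -> Sigma) :
  bracket_word R [set n : nat | (1 <= n)%N]%classic a -> poly_complexity a.
Proof.
move=> [g [col [[f gf gE] /finite_seqP [s sE] aE]]].
pose u (x : nat * nat) (m : nat) : R := x.1%:R + x.2%:R * m%:R.
have tu : tame u.
  apply: tame_add; first exact: tame_fst (fun x => x.1%:R).
  by apply: tame_mul; [exact: tame_fst (fun x => x.2%:R)|exact: tame_snd].
have [J [C hC]] := tame_gp gf tu.
exists (C + (size s).+1 * #|J|.+1)%N => N.
have [K [tau [c [w [cK _ hw]]]]] := hC N.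
pose E : finType := ('I_N.+1 * 'I_(size s))%type.
have hk t := @halfspace_classes R (nat * nat) E J c
   (fun e j => (w t j e.1)%:~R) (fun e => s`_(e.2)).
have [k {}hk] := choice hk.
exists _, (fun x => (tau x, k (tau x) x)); split.
  rewrite card_prod card_ord expnD leq_mul // expnM leq_exp2r //.
  by rewrite card_prod !card_ord; apply: leq_grid_exp (leq_exp_self _ _).
move=> x y x0 y0 [tE kE] m mN; rewrite !aE /= ?ltn_addr //; congr (col _).
have gs n : (0 < n)%N -> exists2 i, (i < size s)%N & s`_i = g n.
  move=> n0; have : ((g @` [set n | (1 <= n)%N])%classic) (g n) by exists n.
  by rewrite sE /= => /(nthP 0) [i]; exists i.
have gu z : (0 < z.1)%N -> g (z.1 + z.2 * m)%N = \sum_j c z j * (w (tau z) j m)%:~R.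
  by move=> z0; rewrite gE /= ?ltn_addr // natrD natrM -hw.
have half z z' : (0 < z.1)%N -> (0 < z'.1)%N -> tau z = tau z' ->
    k (tau z) z = k (tau z) z' -> g (z.1 + z.2 * m)%N <= g (z'.1 + z'.2 * m)%N.
  move=> z0 z0' tzE kzE; have [//|i lt iE] := gs (z.1 + z.2 * m)%N.
    by rewrite ltn_addr.
  have := hk _ _ _ kzE (Ordinal (n := N.+1) mN, Ordinal lt).
  by rewrite /= -gu // [in X in _ = X]tzE -gu // iE lexx.
move: kE; rewrite -tE => kE.
by apply/eqP; rewrite eq_le !half // -tE.
Qed.

(** * Primes not congruent to 1 *)

Local Open Scope nat_scope.

Definition prime_ne1 (d p : nat) := [&& prime p, coprime p d & p != 1 %[mod d]].

Definition count_primes_ne1 (d X : nat) := \sum_(0 <= p < X.+1 | prime_ne1 d p) 1.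

Lemma exp_homo e : {homo expn^~ e : m n / m <= n}.
Proof. by case: e => // e m n le; rewrite leq_exp2r. Qed.

Lemma eqmod1_of_primes d m : 0 < m ->
  (forall p, prime p -> p %| m -> p = 1 %[mod d]) -> m = 1 %[mod d].
Proof.
have [n] := ubnP m; elim: n m => // n IH m /ltnSE le m0 h.
have [m1|m1] := leqP m 1; first by congr (_ %% _); lia.
have pm := pdiv_dvd m; have pp := pdiv_prime m1.
have := divnK pm; set k := m %/ pdiv m => e.
have k0 : 0 < k by rewrite divn_gt0 ?prime_gt0 // dvdn_leq.
have km : k < m by rewrite ltn_Pdiv // prime_gt1.
rewrite -e -modnMm (h _ pp pm) (IH k) ?modnMm ?muln1 //.
  exact: leq_trans km le.
by move=> p p1 pk; apply: h => //; rewrite (dvdn_trans pk) // -e dvdn_mulr.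
Qed.

(** A product of primes that are 1 modulo d is 1 modulo d, and -1 is not 1 since
    d > 2. *)
Lemma prime_ne1_factor d n : 2 < d -> d %| n.+1 ->
  exists2 p, prime_ne1 d p & p %| n.
Proof.
move=> d2 dn.
have n0 : 0 < n by case: n dn => //; rewrite dvdn1; case: d d2 => [|[|]].
have cop p : p %| n -> coprime p d.
  by move=> pn; rewrite (coprime_dvdl pn) // (coprime_dvdr dn) // coprimenS.
have [/hasP[p] |/hasPn no] := boolP (has (prime_ne1 d) (primes n)).
  by rewrite mem_primes => /and3P[_ _ pn] gp; exists p.
have : n = 1 %[mod d].
  apply: eqmod1_of_primes => // p pp pn; apply/eqP.
  have /no : p \in primes n by rewrite mem_primes pp n0.
  by rewrite /prime_ne1 pp cop //= negbK.
move=> /(congr1 (fun k => k + 1)) /(congr1 (modn^~ d)).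
rewrite !modnDml addn1 (eqP dn) => /esym/eqP; rewrite -/(d %| _) => /dvdn_leq; lia.
Qed.

Lemma card_mod_class X m c : 0 < m ->
  X %/ m <= \sum_(0 <= x < X | x == c %[mod m]) 1 <= (X %/ m).+1.
Proof.
move=> m0.
have block b : \sum_(b * m <= x < b.+1 * m | x == c %[mod m]) 1 = 1.
  rewrite mulSn addnC -[X in \sum_(X <= _ < _ | _) _]add0n big_addn addKn.
  under eq_bigl do rewrite addnC modnMDl.
  rewrite big_mkord (big_pred1 (Ordinal (ltn_pmod c m0))) // => i /=.
  by rewrite modn_small // -val_eqE.
have full b : \sum_(0 <= x < b * m | x == c %[mod m]) 1 = b.
  elim: b => [|b IH]; first by rewrite mul0n big_nil.
  by rewrite (big_cat_nat (n := b * m)) //= ?leq_pmul2r // IH block addn1.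
have mono a b : a <= b -> \sum_(0 <= x < a | x == c %[mod m]) 1 <=
    \sum_(0 <= x < b | x == c %[mod m]) 1.
  by move=> ab; rewrite [X in _ <= X](big_cat_nat (n := a)) //= leq_addr.
rewrite -{1}[X %/ m]full -[X in _ && (_ <= X)]full; apply/andP; split; apply: mono.
  exact: leq_divM.
by rewrite ltnW // ltn_ceil.
Qed.

(** Two terms of the progression divisible by p have indices congruent modulo
    p. *)
Lemma card_dvd_progression p Q c M : prime p -> ~~ (p %| Q) ->
  \sum_(0 <= t < M | p %| Q * t + c) 1 <= (M %/ p).+1.
Proof.
move=> pp pQ.
have [/hasP[t0 _ ht0]|/hasPn no] := boolP (has (fun t => p %| Q * t + c) (index_iota 0 M)).
  have /andP[_ h] := @card_mod_class M p t0 (prime_gt0 pp).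
  apply: leq_trans h; rewrite big_mkcond [X in _ <= X]big_mkcond /=.
  apply: leq_sum => t _; case: ifP => // ht; case: ifP => //.
  move/negP; case; wlog le : t t0 ht0 ht / t0 <= t.
    by move=> h; case: (leqP t0 t) => [/h|/ltnW/h]; [|rewrite eq_sym]; apply.
  rewrite eqn_mod_dvd //.
  have := dvdn_sub ht ht0; rewrite subnDr -mulnBr Euclid_dvdM //.
  by rewrite (negbTE pQ).
by rewrite big_nat_cond big_pred0 // => t; apply/negP => /andP[h]; apply/negP/no; rewrite mem_index_iota.
Qed.

Local Open Scope ring_scope.

(** Dyadic summation: the primes between 2^i and 2^(i+1) contribute at most
    2 / (i+1)^2, which is at most 2/i - 2/(i+1). *)
Lemma sum_inv_primes_ne1 d I0 : (0 < I0)%N ->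
  (forall I, (I0 <= I)%N -> (I ^ 2 * count_primes_ne1 d (2 ^ I) < 2 ^ I)%N) ->
  forall i, (I0 <= i)%N ->
  \sum_(0 <= p < (2 ^ i).+1 | prime_ne1 d p && (2 ^ I0 < p)%N) (p%:R^-1 : rat)
    <= 2 / I0%:R - 2 / i%:R.
Proof.
move=> I00 h; elim=> [|i IH]; first by rewrite leqn0 => /eqP e; rewrite e in I00.
rewrite leq_eqVlt => /predU1P[<-|].
  rewrite subrr big_nat_cond big_pred0 // => p; apply/negP => /andP[/andP[_ h2] /andP[_]].
  by rewrite ltnNge -ltnS h2.
rewrite ltnS => leI; have i0 : (0 < i)%N by lia.
rewrite (big_cat_nat (n := (2 ^ i).+1)) //=; last by rewrite ltnS leq_exp2l.
have {}IH := IH leI.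
have : \sum_((2 ^ i).+1 <= p < (2 ^ i.+1).+1 | prime_ne1 d p && (2 ^ I0 < p)%N)
     (p%:R^-1 : rat) <= 2 / i%:R - 2 / i.+1%:R; last first.
  by move=> /(lerD IH) /le_trans; apply; rewrite addrA subrK.
apply: (@le_trans _ _ (\sum_((2 ^ i).+1 <= p < (2 ^ i.+1).+1 | prime_ne1 d p)
    ((2 ^ i)%:R^-1 : rat))).
  rewrite big_nat_cond [leRHS]big_nat_cond big_mkcond [leRHS]big_mkcond /=.
  apply: ler_sum => p _; case: ifP => [/andP[/andP[a b] /andP[-> _]]|_].
    rewrite a b /= lef_pV2 ?posrE ?ltr0n ?expn_gt0 //; last by lia.
    by rewrite ler_nat; lia.
  by case: ifP => // _; rewrite invr_ge0.
apply: (@le_trans _ _ ((count_primes_ne1 d (2 ^ i.+1))%:R / (2 ^ i)%:R)).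
  rewrite /count_primes_ne1 natr_sum mulr_suml [leRHS](big_cat_nat (n := (2 ^ i).+1)) //=.
    under [X in _ <= _ + X]eq_bigr do rewrite mul1r.
    by rewrite lerDr sumr_ge0 // => p _; rewrite mul1r invr_ge0.
  by rewrite ltnS leq_exp2l.
have : (i.+1 ^ 2 * count_primes_ne1 d (2 ^ i.+1) < 2 ^ i.+1)%N by apply: h; lia.
set n := count_primes_ne1 _ _.
rewrite -(ltr_nat rat) natrM natrX expnS natrM => hn.
have e0 : 0 < (2 ^ i)%:R :> rat by rewrite ltr0n expn_gt0.
set e : rat := (2 ^ i)%:R in hn e0 *.
have I0' : 0 < i%:R :> rat by rewrite ltr0n.
have -> : 2 / i%:R - 2 / i.+1%:R = 2 / (i%:R * i.+1%:R) :> rat.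
  rewrite -natr1; field; apply/andP; split; lra.
rewrite ler_pdivrMr // mulrAC ler_pdivlMr; last by rewrite mulr_gt0 // ltr0n.
apply: le_trans (ltW hn); rewrite mulrC ler_wpM2r ?ler0n // expr2.
by rewrite ler_wpM2r ?ler_nat // ler0n.
Qed.

(** Otherwise the reciprocals of the primes p that are not 1 modulo d and exceed
    2^J0 have a small sum.  Let Q be the product of d and of the smaller ones
    among these primes.  Each number Q t + Q - 1 is -1 modulo d, hence has a prime
    factor that is not 1 modulo d; this factor is prime to Q, hence large.  But
    too few t < M have this property: each p accounts for at most M/p + 1 of
    them. *)
Lemma many_primes_ne1 d I0 : (2 < d)%N ->
  exists2 I, (I0 <= I)%N & (2 ^ I <= I ^ 2 * count_primes_ne1 d (2 ^ I))%N.
Proof.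
move=> d2; apply: contrapT => no.
pose J0 := maxn I0 16.
have h I : (J0 <= I)%N -> (I ^ 2 * count_primes_ne1 d (2 ^ I) < 2 ^ I)%N.
  move=> le; rewrite ltnNge; apply/negP => le2; apply: no; exists I => //.
  by rewrite (leq_trans _ le) // leq_maxl.
have J16 : (16 <= J0)%N by rewrite leq_maxr.
pose Q := (d * \prod_(0 <= p < (2 ^ J0).+1 | prime_ne1 d p) p)%N.
have Q0 : (0 < Q)%N.
  rewrite muln_gt0 prodn_cond_gt0 ?(ltn_trans _ d2) // => p /and3P[pp _ _].
  exact: prime_gt0.
(* The numbers Q t + Q - 1 with t < M are below Z = 2^(Q + I); I is so large that
   the density 1/(Q + I)^2 of the primes up to Z compensates the factor 2^Q. *)
pose I := (2 ^ Q + J0)%N; pose M := (2 ^ I)%N.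
pose P p := prime_ne1 d p && (2 ^ J0 < p)%N.
pose Z := (2 ^ (Q + I))%N.
have count : (M <= \sum_(0 <= p < Z.+1 | P p && ~~ (p %| Q)) (M %/ p).+1)%N.
  apply: (@leq_trans (\sum_(0 <= p < Z.+1 | P p && ~~ (p %| Q))
       \sum_(0 <= t < M | p %| Q * t + Q.-1) 1)%N); last first.
    apply: leq_sum => p /andP[/andP[/and3P[pp _ _] _] pQ].
    exact: card_dvd_progression.
  under eq_bigr do rewrite big_mkcond.
  rewrite exchange_big -[X in (X <= _)%N]subn0 -[X in (X <= _)%N]muln1.
  rewrite -sum_nat_const_nat big_nat [X in (_ <= X)%N]big_nat /=.
  apply: leq_sum => t tM; set n := (Q * t + Q.-1)%N.
  have n1 : n.+1 = (Q * t.+1)%N by rewrite /n -addnS prednK // mulnS addnC.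
  have dn : (d %| n.+1)%N by rewrite n1 -mulnA dvdn_mulr.
  have [p gp pn] := prime_ne1_factor d2 dn.
  have /and3P[pp _ _] := gp.
  have pQ : ~~ (p %| Q)%N.
    apply/negP => pQ; have : (p %| n.+1)%N by rewrite n1 dvdn_mulr.
    by rewrite -addn1 dvdn_addr // dvdn1 => /eqP p1; rewrite p1 in pp.
  have pJ : (2 ^ J0 < p)%N.
    rewrite ltnNge; apply: contra pQ => le.
    by rewrite dvdn_mull // (big_rem p) ?gp ?dvdn_mulr //= mem_index_iota ltnS.
  have pZ : (p < Z.+1)%N.
    have n0 : (0 < n)%N by have := dvdn_leq (ltn0Sn n) dn; lia.
    rewrite ltnS (leq_trans (dvdn_leq n0 pn)) // -ltnS n1 leqW //.
    by rewrite /Z expnD leq_mul // ltnW // ltn_expl.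
  rewrite (big_rem p) /=; last by rewrite mem_index_iota.
  by rewrite /P gp pJ pQ pn /= leq_addr.
have {}count : (M <= \sum_(0 <= p < Z.+1 | P p) (M %/ p).+1)%N.
  apply: leq_trans count _; rewrite big_mkcond [X in (_ <= X)%N]big_mkcond /=.
  by apply: leq_sum => p _; case: ifP => // /andP[->].
have IJ : (J0 <= Q + I)%N by rewrite /I; lia.
have s1 := sum_inv_primes_ne1 (leq_trans (isT : 0 < 16)%N J16) h IJ.
have s2 := h _ IJ.
have I2 : (4 * 2 ^ Q <= (Q + I) ^ 2)%N.
  have : (2 ^ Q <= Q + I)%N by rewrite /I; lia.
  have : (4 <= Q + I)%N by lia.
  by move=> *; rewrite -mulnn leq_mul.
have : (M%:R : rat) <= M%:R * (\sum_(0 <= p < Z.+1 | P p) p%:R^-1) + (count_primes_ne1 d Z)%:R.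
  apply: le_trans (_ : (\sum_(0 <= p < Z.+1 | P p) (M %/ p).+1)%:R <= _); first by rewrite ler_nat.
  rewrite natr_sum mulr_sumr.
  apply: (@le_trans _ _ (\sum_(0 <= p < Z.+1 | P p) (M%:R / p%:R + 1))).
    apply: ler_sum => p /andP[/and3P[pp _ _] _].
    by rewrite -natr1 lerD2r ler_pdivlMr ?ltr0n ?prime_gt0 // -natrM ler_nat leq_divM.
  rewrite big_split /= lerD2l natr_sum big_mkcond [leRHS]big_mkcond /=.
  by apply: ler_sum => p _; rewrite /P; case: prime_ne1 => //=; case: ifP => //; rewrite ler01.
apply/negP; rewrite -ltNge.
have M0 : 0 < (M%:R : rat) by rewrite ltr0n expn_gt0.
have J0r : 2 / J0%:R <= 1 / 8 :> rat.
  by rewrite ler_pdivrMr ?ltr0n; [have : 16%:R <= J0%:R :> rat by rewrite ler_nat|]; lia || lra.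
have S8 : \sum_(0 <= p < Z.+1 | P p) p%:R^-1 <= 1 / 8 :> rat.
  apply: le_trans s1 (le_trans _ J0r); rewrite gerBl divr_ge0 ?ler0n //.
have cZ : (4 * count_primes_ne1 d Z < M)%N.
  rewrite -(ltn_pmul2l (expn_gt0 2 Q : (0 < _)%N)) mulnA -expnD.
  apply: leq_ltn_trans s2; rewrite -/Z leq_mul2r; apply/orP; right.
  by rewrite mulnC.
have {}cZ : 4 * (count_primes_ne1 d Z)%:R < M%:R :> rat by rewrite -natrM ltr_nat.
set S := \sum_(_ <= _ < _ | _) _ in S8 *; nra.
Qed.

(** * Totients modulo an odd prime *)

Local Open Scope nat_scope.

(** With D = B + 1 and n close to D q, the power n^B is at most D^B 2^(q B), which
    is smaller than 2^n by a factor of at least D^(-B) 2^q. *)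
Lemma poly_lt_exp2 A B : exists n0, forall n, n0 <= n -> A * n ^ B < 2 ^ n.
Proof.
exists (A * B.+1 ^ B * B.+1) => n; rewrite -leq_divRL //.
set q := n %/ B.+1 => le.
have nq : n <= B.+1 * 2 ^ q.
  have h : n < q.+1 * B.+1 by rewrite /q; apply: ltn_ceil.
  by rewrite (leq_trans (ltnW h)) // mulnC leq_mul2l /= ltn_expl.
have qB : q * B + q <= n by rewrite -mulnSr leq_divM.
apply: (@leq_ltn_trans (A * B.+1 ^ B * 2 ^ (q * B))).
  by rewrite -mulnA leq_mul2l expnM -expnMn exp_homo ?orbT.
apply: leq_trans (_ : 2 ^ (q * B + q) <= _); last by rewrite leq_exp2l.
by rewrite expnD mulnC ltn_pmul2l ?expn_gt0 // (leq_ltn_trans le) // ltn_expl.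
Qed.

Lemma poly_complexity_coarsen (T U : Type) (a : nat -> T) (b : nat -> U) :
  (forall m n, a m = a n -> b m = b n) -> poly_complexity a -> poly_complexity b.
Proof.
move=> ab [C h]; exists C => N; have [K [k [cK hk]]] := h N.
by exists K, k; split=> // x y x0 y0 kxy m mN; apply/ab/hk.
Qed.

Lemma totient_mulp_dvd p x : prime p -> 0 < x -> p %| x ->
  totient (x * p) = totient x * p.
Proof.
move=> pp x0 px; have [m cm e] := pfactor_coprime pp x0.
have e0 : 0 < logn p x by rewrite logn_gt0 mem_primes pp x0.
rewrite e -mulnA -expnSr !totient_coprime ?coprimeXr 1?coprime_sym //.
by rewrite !totient_pfactor // /= -!mulnA -expnSr prednK.
Qed.

Lemma coprime_prod_primes p (s : seq nat) : prime p -> all prime s -> p \notin s ->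
  coprime (\prod_(i <- s) i) p.
Proof.
move=> pp; elim: s => [|a s IH] /=; first by rewrite big_nil coprime1n.
rewrite inE big_cons => /andP[pa ps] /norP[na ns].
rewrite coprimeMl IH // andbT prime_coprime // dvdn_prime2 //.
by rewrite eq_sym.
Qed.

Lemma totient_prod_primes (s : seq nat) : uniq s -> all prime s ->
  totient (\prod_(i <- s) i) = \prod_(i <- s) i.-1.
Proof.
elim: s => [|a s IH] /=; first by rewrite !big_nil.
move=> /andP[ns us] /andP[pa ps]; rewrite !big_cons totient_coprime.
  by rewrite IH // totient_prime.
by rewrite coprime_sym coprime_prod_primes.
Qed.

(** The window m |-> phi (x + x m) at x = x_S, the product of the primes in S,
    determines S: at m = 0 it gives phi x_S, and at m = p - 1 it gives
    phi (x_S p), which is phi x_S times p or p - 1 according as p divides x_S or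
    not. *)
Lemma totient_mod_odd_prime r : prime r -> 2 < r ->
  ~ poly_complexity (fun n => totient n %% r).
Proof.
move=> pr r2 [C hC].
have [n0 hn0] := poly_lt_exp2 (2 * C) 3.
have [I leI hI] := many_primes_ne1 (maxn n0 1) r2.
pose X := 2 ^ I; have [K [k [cK hk]]] := hC X.-1.
have X0 : 0 < X by rewrite expn_gt0.
rewrite prednK // in cK.
pose G := [set p : 'I_X.+1 | prime_ne1 r p]%SET.
have cG : #|G| = count_primes_ne1 r X.
  by rewrite /count_primes_ne1 big_mkord sum1dep_card.
pose sq (S : {set 'I_X.+1}) : seq nat := map val (enum S).
pose x S := \prod_(p <- sq S) p.
have sqP (S : {set 'I_X.+1}) (p : 'I_X.+1) : (val p \in sq S) = (p \in S).
  by rewrite mem_map ?mem_enum //; apply: val_inj.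
have sqU S : uniq (sq S) by rewrite map_inj_uniq ?enum_uniq //; apply: val_inj.
have sqG (S : {set 'I_X.+1}) : S \subset G -> all (prime_ne1 r) (sq S).
  move=> /fintype.subsetP SG; apply/allP => _ /mapP [p pS ->].
  by move: pS; rewrite mem_enum => /SG; rewrite inE.
have sqp (S : {set 'I_X.+1}) : S \subset G -> all prime (sq S).
  by move=> /sqG; apply: sub_all => p /and3P[].
have x0 (S : {set 'I_X.+1}) : S \subset G -> 0 < x S.
  move=> /sqp /allP h; rewrite /x big_seq prodn_cond_gt0 // => p /h.
  exact: prime_gt0.
have ux (S : {set 'I_X.+1}) : S \subset G -> coprime r (totient (x S)).
  move=> SG; rewrite totient_prod_primes ?sqp // big_seq.
  elim/big_ind: _ => [||p ps]; first by rewrite coprimen1.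
    by move=> a b; rewrite coprimeMr => -> ->.
  rewrite prime_coprime //; have /allP /(_ _ ps) /and3P[pp _] := sqG _ SG.
  by rewrite eqn_mod_dvd ?prime_gt0 // subn1.
have inj (S S' : {set 'I_X.+1}) : S \subset G -> S' \subset G ->
    k (x S, x S) = k (x S', x S') -> S \subset S'.
  move=> SG SG' kSS; apply/fintype.subsetP => p pS; apply: contraT => pS'.
  have hw m : m <= X.-1 -> totient (x S * m.+1) = totient (x S' * m.+1) %[mod r].
    by move=> mX; have := hk (x S, x S) (x S', x S') (x0 _ SG) (x0 _ SG') kSS _ mX; rewrite /= -!mulnS.
  have pp : prime p by have /allP := sqp _ SG; apply; rewrite sqP.
  have p0 := prime_gt0 pp.
  have h0 := hw 0 isT; rewrite !muln1 in h0.
  have := hw p.-1; rewrite prednK // totient_mulp_dvd //; last 2 first.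
  - exact: x0.
  - by rewrite /x (big_rem (val p)) ?sqP //= dvdn_mulr.
  rewrite [in X in _ = X]totient_coprime; last first.
    by rewrite coprime_prod_primes ?sqp // sqP.
  rewrite -modnMml h0 modnMml (totient_prime pp) => /(_ _)/eqP.
  rewrite eqn_mod_dvd ?leq_mul2l ?leq_pred ?orbT //.
  rewrite -mulnBr -[X in X - _](prednK p0) subSnn muln1.
  have px : p.-1 <= X.-1 by have := ltn_ord p; lia.
  by move=> /(_ px); rewrite -[_ %| _]negbK -prime_coprime // ux.
have : 2 ^ #|G| <= #|K|.
  rewrite -card_powerset -(card_in_imset (f := fun S => k (x S, x S))) ?max_card //.
  move=> S S'; rewrite !powersetE => SG SG' e.
  apply/eqP; rewrite finset.eqEsubset; apply/andP; split.
    exact: (inj _ _ SG SG' e).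
  exact: (inj _ _ SG' SG (esym e)).
move=> /leq_trans /(_ cK); rewrite cG => cle.
have nc : count_primes_ne1 r X <= I.+1 * C.
  rewrite -(leq_exp2l (m := 2)) // (leq_trans cle) // expnM exp_homo //.
  by rewrite expnS mul2n -addnn -addn1 leq_add2l.
have := hn0 I (leq_trans (leq_maxl _ _) leI); rewrite ltnNge => /negP; apply.
have I1 : 0 < I := leq_trans (leq_maxr _ _) leI.
apply: leq_trans hI _; apply: leq_trans (leq_mul (leqnn _) nc) _.
have -> : 2 * C * I ^ 3 = I ^ 2 * ((I + I) * C) by ring.
have -> : I.+1 * C = (I + 1) * C by rewrite addn1.
by rewrite leq_mul2l leq_mul2r leq_add2l I1 !orbT.
Qed.

(** * Brun's sieve *)

Local Open Scope ring_scope.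

Definition hits (k : nat) (m : 'I_k -> nat) (p x : nat) : nat :=
  \sum_(i < k) (p %| x + m i)%N.

(** The sum of (-1)^#|D| * prod_(p in D) a p over the subsets D of P with at most
    t elements, by recursion on P.  It truncates the expansion of
    prod_(p <- P) (1 - a p). *)
Fixpoint truncated_product (R : pzRingType) (a : nat -> R) (t : nat) (P : seq nat) : R :=
  if P is p :: P' then
    truncated_product a t P' - (if t is t'.+1 then a p * truncated_product a t' P' else 0)
  else 1.

(** For such p the k classes excluded by hits are distinct. *)
Definition separated (k : nat) (m : 'I_k -> nat) (p : nat) :=
  forall i j : 'I_k, i != j -> m i != m j %[mod p].

Lemma hits_le1 k (m : 'I_k -> nat) p x : separated m p -> (hits m p x <= 1)%N.
Proof.
move=> sep; have [/existsP[i hi]|/existsPn no] := boolP [exists i, (p %| x + m i)%N].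
  rewrite /hits (bigD1 i) //= hi big1 // => j nij; apply/eqP.
  rewrite eqb0; apply: contra (sep j i nij) => hj.
  by rewrite -(eqn_modDl x) (eqP hi) (eqP hj).
by rewrite /hits big1 // => i _; rewrite (negbTE (no i)).
Qed.

Lemma truncated_product0 (R : pzRingType) (a : nat -> R) (P : seq nat) : truncated_product a 0 P = 1.
Proof. by elim: P => //= p P ->; rewrite subr0. Qed.

(** Bonferroni's inequalities: the truncation of an inclusion-exclusion sum is an
    upper bound at even depth and a lower bound at odd depth. *)
Lemma truncated_product_alternates (R : realDomainType) (a : nat -> R) (P : seq nat) (t : nat) :
  (forall p, p \in P -> 0 <= a p <= 1) ->
  0 <= (-1) ^+ t * (truncated_product a t P - \prod_(p <- P) (1 - a p)).
Proof.
elim: P t => [|p P IH] t h /=; first by rewrite big_nil subrr mulr0.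
have {}IH t' := IH t' (fun q qP => h q (mem_behead (s := p :: P) qP)).
have /andP[a0 a1] := h p (mem_head _ _).
rewrite big_cons mulrBl mul1r; set Q := \prod_(_ <- P) _ in IH *.
case: t => [|t].
  have Q0 : 0 <= a p * Q.
    rewrite mulr_ge0 // /Q big_seq prodr_ge0 // => q qP.
    by have /andP[_] := h q (mem_behead (s := p :: P) qP); rewrite subr_ge0.
  by have := IH 0%N; rewrite expr0 !mul1r subr0 => IH0; lra.
have h1 := IH t.+1; have := mulr_ge0 a0 (IH t); rewrite exprS in h1 *.
set s := (-1) ^+ t; rewrite !mulN1r in h1 *.
set A := truncated_product a t.+1 P in h1 *; set B := truncated_product a t P in h1 *.
move=> h2.
have -> : - s * (A - a p * B - (Q - a p * Q)) = - s * (A - Q) + a p * (s * (B - Q)) by ring.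
exact: addr_ge0.
Qed.

(** Rankin's trick: each omitted subset D has more than t elements, so its weight
    is at most 2^(#|D| - t) prod_(p in D) a p. *)
Lemma truncated_product_error (R : realFieldType) (a : nat -> R) (P : seq nat) (t : nat) :
  (forall p, p \in P -> 0 <= a p <= 1) ->
  `|truncated_product a t P - \prod_(p <- P) (1 - a p)| <= 2^-1 ^+ t * \prod_(p <- P) (1 + 2 * a p).
Proof.
elim: P t => [|p P IH] t h /=.
  by rewrite !big_nil subrr normr0 mulr1 exprn_ge0 // invr_ge0 ler0n.
have hP q : q \in P -> 0 <= a q <= 1 by move=> qP; apply: h; rewrite inE qP orbT.
have {}IH t' := IH t' hP.
have /andP[a0 a1] := h p (mem_head _ _).
rewrite !big_cons; set Q := \prod_(_ <- P) (1 - _) in IH *.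
set W := \prod_(_ <- P) _ in IH *.
have W0 : 0 <= W.
  rewrite /W big_seq prodr_ge0 // => q /hP /andP[]; lra.
case: t => [|t].
  rewrite expr0 mul1r subr0 truncated_product0.
  have Q0 : 0 <= Q.
    by rewrite /Q big_seq prodr_ge0 // => q /hP /andP[]; rewrite subr_ge0.
  have Q1 : Q <= 1.
    by rewrite /Q big_seq prodr_ile1 // => q /hP /andP[? ?]; apply/andP; split; lra.
  have W1 : 1 <= W.
    rewrite /W big_seq; elim/big_ind: _ => [//|x y|q /hP /andP[? _]]; last lra.
    by move=> *; rewrite mulr_ege1.
  rewrite ger0_norm; last by rewrite subr_ge0 mulr_ile1 // ?subr_ge0 //; lra.
  apply: (@le_trans _ _ 1); last by rewrite mulr_ege1 //; lra.
  by rewrite gerBl mulr_ge0 // subr_ge0.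
have -> : truncated_product a t.+1 P - a p * truncated_product a t P - (1 - a p) * Q =
  (truncated_product a t.+1 P - Q) - a p * (truncated_product a t P - Q) by ring.
apply: le_trans (ler_normB _ _) _; rewrite normrM (ger0_norm a0).
apply: le_trans (lerD (IH t.+1) (ler_wpM2l a0 (IH t))) _.
by rewrite exprS; set e := _ ^+ t; rewrite le_eqVlt; apply/orP; left; apply/eqP; field.
Qed.

(** Averaging over x in a residue class replaces the indicator of a hit at p by
    its density k/p.  In the recursion, by the Chinese remainder theorem, x hits
    p exactly if it lies in one of k classes modulo M p; each subset D
    of P contributes at most k^#|D| to the error. *)
Lemma truncated_product_average (k : nat) (m : 'I_k -> nat) (X : nat) (P : seq nat) (t M c : nat) :
  uniq P -> all prime P -> (forall p, p \in P -> separated m p) ->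
  (0 < M)%N -> all (fun p => coprime M p) P ->
  `|\sum_(0 <= x < X | x == c %[mod M]) truncated_product (fun p => (hits m p x)%:R : rat) t P
    - X%:R / M%:R * truncated_product (fun p => k%:R / p%:R) t P| <= ((1 + k * size P) ^ t)%:R.
Proof.
elim: P t M c => [|p P IH] t M c /=.
  move=> _ _ _ M0 _; rewrite mulr1 muln0 addn0 exp1n.
  have /andP[h1 h2] := card_mod_class X c M0.
  rewrite -(natr_sum _ _ _ (fun=> 1%N)) ler_norml.
  set S := (\sum_(_ <= _ < _ | _) _)%N in h1 h2 *.
  have M0r : 0 < M%:R :> rat by rewrite ltr0n.
  have X1 : (X %/ M)%:R <= X%:R / M%:R :> rat.
    by rewrite ler_pdivlMr // -natrM ler_nat leq_divM.
  have X2 : X%:R / M%:R <= (X %/ M)%:R + 1 :> rat.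
    by rewrite ler_pdivrMr // natr1 -natrM ler_nat ltnW // ltn_ceil.
  rewrite -(ler_nat rat) in h1; rewrite -(ler_nat rat) -natr1 in h2.
  by apply/andP; split; lra.
move=> /andP[pP uP] /andP[pp aP] sep M0 /andP[Mp MP].
have sepP q : q \in P -> separated m q by move=> qP; apply: sep; rewrite inE qP orbT.
have {}IH t' M' c' := IH t' M' c' uP aP sepP.
case: t => [|t].
  rewrite subr0; under eq_bigr do rewrite subr0.
  by have := IH 0%N M c M0 MP; rewrite !expn0.
rewrite [\sum_(_ <= _ < _ | _) _]sumrB mulrBr.
pose r i := chinese M p c (p - m i %% p)%N.
have rE i x : (x == c %[mod M]) && (p %| x + m i)%N = (x == r i %[mod M * p]).
  rewrite chinese_remainder // /r !chinese_modl // chinese_modr //; congr (_ && _).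
  rewrite -[RHS](eqn_modDr (m i)) -[X in _ = (_ == X)]modnDmr subnK ?modnn //.
  by rewrite ltnW // ltn_pmod // prime_gt0.
have split : \sum_(0 <= x < X | x == c %[mod M])
      (hits m p x)%:R * truncated_product (fun q => (hits m q x)%:R) t P =
    \sum_(i < k) \sum_(0 <= x < X | x == r i %[mod M * p])
      truncated_product (fun q => (hits m q x)%:R : rat) t P.
  transitivity (\sum_(0 <= x < X | x == c %[mod M]) \sum_(i < k)
      (p %| x + m i)%:R%N * truncated_product (fun q => (hits m q x)%:R : rat) t P).
    by apply: eq_bigr => x _; rewrite -mulr_suml -natr_sum.
  rewrite exchange_big; apply: eq_bigr => i _ /=.
  rewrite big_mkcond [RHS]big_mkcond; apply: eq_bigr => x _.
  rewrite -rE; case: eqP => //= _.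
  by case: (p %| _)%N; rewrite ?mul1r ?mul0r.
rewrite split.
have IHi (i : 'I_k) : `|\sum_(0 <= x < X | x == r i %[mod M * p])
      truncated_product (fun q => (hits m q x)%:R : rat) t P
    - X%:R / (M * p)%:R * truncated_product (fun p => k%:R / p%:R) t P| <= ((1 + k * size P) ^ t)%:R.
  apply: IH; first by rewrite muln_gt0 M0 prime_gt0.
  apply/allP => q qP; rewrite coprimeMl (allP MP) //= prime_coprime //.
  rewrite dvdn_prime2 //; last exact: (allP aP).
  by apply: contraNneq pP => ->.
have -> : X%:R / M%:R * (k%:R / p%:R * truncated_product (fun q => k%:R / q%:R) t P) =
   \sum_(i < k) (X%:R / (M * p)%:R * truncated_product (fun q => k%:R / q%:R : rat) t P).
  rewrite sumr_const card_ord -mulr_natr natrM; field.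
  by rewrite !pnatr_eq0 -!lt0n M0 prime_gt0.
set A := \sum_(_ <= _ < _ | _) truncated_product _ t.+1 P; set B := \sum_(i < k) _.
set C := _ * truncated_product _ t.+1 P; set D := \sum_(i < k) _.
have -> : A - B - (C - D) = (A - C) - (B - D) by ring.
have BD : `|B - D| <= (k * (1 + k * size P) ^ t)%:R.
  rewrite -sumrB; apply: le_trans (ler_norm_sum _ _ _) _.
  apply: le_trans (ler_sum _ (fun i _ => IHi i)) _.
  by rewrite sumr_const card_ord -mulrnA mulnC.
apply: le_trans (ler_normB _ _) _.
apply: le_trans (lerD (IH t.+1 M c M0 MP) BD) _.
rewrite -natrD ler_nat expnS -mulnDl mulnS addnCA [(k + _)%N]addnC expnS leq_mul2l.
by rewrite exp_homo ?orbT // leq_addr.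
Qed.

(** * Euler's product and the resulting sieve bound *)

Local Open Scope ring_scope.

Lemma separated_leq k (m : 'I_k -> nat) p : (0 < p)%N -> separated m p -> (k <= p)%N.
Proof.
move=> p0 sep; pose f i := Ordinal (ltn_pmod (m i) p0).
have fi : injective f.
  move=> i j [e]; apply/eqP; apply: contraT => /sep.
  by rewrite e eqxx.
by have := leq_card f fi; rewrite !card_ord.
Qed.

Lemma bernoulli (R : realDomainType) (x : R) n : -1 <= x -> 1 + n%:R * x <= (1 + x) ^+ n.
Proof.
move=> x1; elim: n => [|n IH]; first by rewrite mul0r addr0 expr0.
rewrite exprS -natr1; apply: le_trans (_ : (1 + x) * (1 + n%:R * x) <= _).
  have : 0 <= n%:R * x ^+ 2 by rewrite mulr_ge0 ?ler0n ?sqr_ge0.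
  by rewrite expr2; lra.
by apply: ler_wpM2l => //; lra.
Qed.

(** Brun's pure sieve: the even truncation is an upper bound for the indicator of
    an x without hits, and its average is computed up to an error that does not
    depend on X. *)
Lemma brun_sieve k (m : 'I_k -> nat) (X s : nat) (P : seq nat) :
  uniq P -> all prime P -> (forall p, p \in P -> separated m p) ->
  (\sum_(0 <= x < X | all (fun p => hits m p x == 0%N) P) 1)%:R <=
    X%:R * (\prod_(p <- P) (1 - k%:R / p%:R)
            + 2^-1 ^+ (2 * s) * \prod_(p <- P) (1 + 2 * (k%:R / p%:R)))
    + ((1 + k * size P) ^ (2 * s))%:R :> rat.
Proof.
move=> uP aP sep; pose a p : rat := k%:R / p%:R.
have a01 p : p \in P -> 0 <= a p <= 1.
  move=> pP; have p0 := prime_gt0 (allP aP p pP).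
  rewrite /a divr_ge0 ?ler0n //= ler_pdivrMr ?ltr0n // mul1r ler_nat.
  exact: separated_leq (sep _ pP).
have h := @truncated_product_average k m X P (2 * s) 1 0 uP aP sep isT.
have {}h := h (introT allP (fun p _ => coprime1n p)).
rewrite divr1 (eq_bigl xpredT) in h; last by move=> x; rewrite !modn1.
have := truncated_product_error (2 * s) a01; rewrite ler_norml => /andP[_ t1].
move: h; rewrite ler_norml => /andP[_ h].
have ind : (\sum_(0 <= x < X | all (fun p => hits m p x == 0%N) P) 1)%:R <=
  \sum_(0 <= x < X) truncated_product (fun p => (hits m p x)%:R : rat) (2 * s) P.
  rewrite natr_sum big_mkcond; apply: ler_sum => x _.
  have b01 p : p \in P -> 0 <= ((hits m p x)%:R : rat) <= 1.
    by move=> /sep /(hits_le1 x) le; rewrite ler0n lern1.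
  have := truncated_product_alternates (2 * s) b01; rewrite exprM sqrrN !expr1n mul1r subr_ge0.
  apply: le_trans; case: ifP => [al|_].
    rewrite big_seq big1 // => p pP.
    by rewrite (eqP (allP al p pP)) subr0.
  by rewrite big_seq prodr_ge0 // => p /b01 /andP[_]; rewrite subr_ge0.
apply: le_trans ind _; rewrite -lerBlDl; apply: le_trans h.
by rewrite lerD2l lerN2 ler_wpM2l ?ler0n // -lerBlDl.
Qed.

(** Splitting off the multiples of p shows that the sum S of the reciprocals of the
    numbers n <= z composed of primes in p :: P is at most S/p plus the same
    sum for P. *)
Lemma euler_product (P : seq nat) (z : nat) : all prime P ->
  \prod_(p <- P) (1 - p%:R^-1) *
    \sum_(n < z.+1 | (0 < n)%N && all (mem P) (primes n)) n%:R^-1 <= 1 :> rat.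
Proof.
elim: P => [|p P IH] /=.
  move=> _; rewrite big_nil mul1r.
  have [->|z0] := posnP z.
    by rewrite big_pred0 => [|[[|//] ?]].
  rewrite (big_pred1 (Ordinal (z0 : (1 < z.+1)%N))) /= ?invr1 // => n.
  apply/andP/eqP => [[n0 pn]|->] //; apply/val_inj => /=.
  apply/eqP; rewrite eqn_leq n0 andbT leqNgt; apply/negP => n1.
  by have /(allP pn) : pdiv n \in primes n by rewrite mem_primes pdiv_prime ?n0 ?pdiv_dvd.
move=> /andP[pp aP]; rewrite big_cons; apply: le_trans (IH aP).
set S := \sum_(_ < _ | _) _; rewrite mulrAC mulrC ler_wpM2l //.
  rewrite big_seq prodr_ge0 // => q qP; rewrite subr_ge0 invf_le1 ?ltr0n ?ler1n.
    exact: prime_gt0 (allP aP q qP).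
  exact: prime_gt0 (allP aP q qP).
have p0 : (0 < p)%N := prime_gt0 pp.
rewrite mulrBl mul1r lerBlDr {1}/S (bigID (fun n : 'I_z.+1 => (p %| n)%N)) /= addrC.
apply: lerD.
  rewrite big_mkcond [leRHS]big_mkcond; apply: ler_sum => n _.
  case: ifP => [/andP[/andP[n0 al] pn]|_]; last first.
    by case: ifP => // _; rewrite invr_ge0 ler0n.
  rewrite n0 ifT //; apply/allP => q qn; have := allP al q qn; rewrite inE => /predU1P[e|//].
  by move: qn; rewrite e mem_primes (negbTE pn) !andbF.
rewrite mulr_sumr.
apply: (@le_trans _ _ (\sum_(n < z.+1) \sum_(n' < z.+1 |
    [&& (0 < n')%N, all (mem (p :: P)) (primes n') & n == n' * p :> nat]%N)
      p%:R^-1 * n'%:R^-1)).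
  rewrite big_mkcond; apply: ler_sum => n _; case: ifP => [|_]; last first.
    by rewrite sumr_ge0 // => n' _; rewrite mulr_ge0 ?invr_ge0 ?ler0n.
  move=> /andP[/andP[n0 al] pn].
  have nz : (n %/ p < z.+1)%N by rewrite (leq_ltn_trans (leq_div _ _)).
  rewrite (bigD1 (Ordinal nz)) /=; last first.
    rewrite divn_gt0 // dvdn_leq // divnK // eqxx andbT.
    apply/allP => q; rewrite mem_primes => /and3P[pq _ qn]; apply: (allP al).
    by rewrite mem_primes pq n0 (dvdn_trans qn) ?dvdn_div.
  rewrite -invfM -natrM mulnC divnK // lerDl sumr_ge0 // => n' _.
  by rewrite mulr_ge0 ?invr_ge0 ?ler0n.
rewrite (exchange_big_dep (fun n : 'I_z.+1 => (0 < n)%N && all (mem (p :: P)) (primes n))) /=;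
  last by move=> n n' _ /and3P[-> ->].
apply: ler_sum => n' /andP[n0 al].
rewrite n0 al /=; have [nz|nz] := ltnP (n' * p) z.+1.
  by rewrite (big_pred1 (Ordinal nz)).
rewrite big_pred0 ?mulr_ge0 ?invr_ge0 ?ler0n // => n.
by apply/negbTE/eqP => e; move: (ltn_ord n); rewrite e ltnNge nz.
Qed.

Lemma harmonic_exp2 l :
  1 + l%:R / 2 <= \sum_(1 <= n < (2 ^ l).+1) n%:R^-1 :> rat.
Proof.
elim: l => [|l IH]; first by rewrite big_nat1 mul0r addr0 invr1.
rewrite (big_cat_nat (n := (2 ^ l).+1)) //=; last by rewrite ltnS leq_exp2l.
rewrite -natr1 mulrDl mul1r addrA; apply: lerD IH _.
apply: (@le_trans _ _ (\sum_((2 ^ l).+1 <= n < (2 ^ l.+1).+1) (2 ^ l.+1)%:R^-1)).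
  rewrite sumr_const_nat subSS expnS mul2n -addnn addnK addnn -mul2n natrM invfM.
  by rewrite -[leRHS]mulr_natr mulfVK ?pnatr_eq0 -?lt0n ?expn_gt0.
apply: ler_sum_nat => n /andP[h1 h2].
by rewrite lef_pV2 ?posrE ?ltr0n ?expn_gt0 ?ler_nat //; lia.
Qed.

(** The n-th smallest element is at least n + 1, and the product of the
    1 - 1/(i + 1) for 1 <= i <= n telescopes to 1/(n + 1). *)
Lemma prod_inv_ge (s : seq nat) : uniq s -> all (leq 2) s ->
  (size s).+1%:R^-1 <= \prod_(p <- s) (1 - p%:R^-1) :> rat.
Proof.
have [b] : exists b, all (geq b) s.
  exists (\max_(i <- s) i)%N; apply/allP => i si /=; exact: leq_bigmax_seq.
elim: b s => [|b IH] s sb us s2.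
  case: s sb s2 {us} => [|a s]; first by rewrite big_nil invr1.
  by move=> /andP[/= a0 _] /andP[a2 _]; have := leq_trans a2 a0.
have [bs|bs] := boolP (b.+1 \in s); last first.
  apply: IH => //; apply/allP => i si /=.
  have : (i <= b.+1)%N := allP sb i si.
  by rewrite leq_eqVlt => /predU1P[e|//]; rewrite e (negbTE bs) in si.
have b1 : (1 < b.+1)%N := allP s2 _ bs.
have {}IH : (size (rem b.+1 s)).+1%:R^-1 <= \prod_(p <- rem b.+1 s) (1 - p%:R^-1) :> rat.
  apply: IH; rewrite ?rem_uniq //; last first.
    by apply/allP => i /mem_rem; apply: (allP s2).
  apply/allP => i; rewrite mem_rem_uniq // inE => /andP[ni si] /=.
  by have : (i <= b.+1)%N := allP sb i si; rewrite leq_eqVlt (negbTE ni).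
have ss : (size s <= b)%N.
  rewrite -(size_iota 2 b); apply: uniq_leq_size => // i si.
  rewrite mem_iota (allP s2 i si : (2 <= i)%N) /=.
  by have : (i <= b.+1)%N := allP sb i si; lia.
have s0 : (0 < size s)%N by case: (s) bs.
move: IH; rewrite (big_rem _ bs) /= size_rem // prednK // => IH.
have b0 : 0 < b%:R :> rat by rewrite ltr0n.
have s0r : 0 < (size s)%:R :> rat by rewrite ltr0n.
apply: le_trans (_ : (1 - b.+1%:R^-1) * (size s)%:R^-1 <= _); last first.
  by rewrite ler_wpM2l // subr_ge0 invf_le1 ?ltr0n // ler1n.
have ssr : (size s)%:R <= b%:R :> rat by rewrite ler_nat.
rewrite ler_pdivlMr // mulrC ler_pdivrMr ?ltr0n // -[(size s).+1%:R]natr1 -[b.+1%:R]natr1.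
rewrite -subr_ge0.
have -> : (1 - (b%:R + 1)^-1) * ((size s)%:R + 1) - (size s)%:R = (b%:R - (size s)%:R) / (b%:R + 1) :> rat.
  by field; lra.
by rewrite divr_ge0 ?subr_ge0 //; lra.
Qed.

Lemma exp2_size_primes n : (0 < n)%N -> (2 ^ size (primes n) <= n)%N.
Proof.
move=> n0; rewrite [leqRHS]prod_prime_decomp // /primes /unzip1 size_map.
have := @mem_prime_decomp n; elim: (prime_decomp n) => [|[p e] s IH] h.
  by rewrite big_nil.
rewrite big_cons /= expnS leq_mul ?IH // => [|q f qf]; last first.
  by apply: h; rewrite inE qf orbT.
have [pp e0 _] := h p e (mem_head _ _).
by rewrite (leq_trans (prime_gt1 pp)) // -[X in (X <= _)%N]expn1 leq_exp2l ?prime_gt1.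
Qed.

(** The primes at which two of the shifts m i coincide divide this number; the
    factor 2 excludes the prime 2 as well. *)
Definition discr k (m : 'I_k -> nat) : nat :=
  (2 * \prod_(ij : 'I_k * 'I_k | m ij.1 < m ij.2) (m ij.2 - m ij.1))%N.

Lemma discr_gt0 k (m : 'I_k -> nat) : (0 < discr m)%N.
Proof. by rewrite muln_gt0 prodn_cond_gt0 // => ij; rewrite subn_gt0. Qed.

Lemma size_primes_discr k (m : 'I_k -> nat) lam :
  (forall i, m i <= 2 ^ lam)%N -> (size (primes (discr m)) <= (k * k * lam).+1)%N.
Proof.
move=> hm; rewrite -(leq_exp2l (m := 2)) // (leq_trans (exp2_size_primes (discr_gt0 m))) //.
rewrite /discr expnS leq_mul2l /=.
apply: (@leq_trans (\prod_(ij : 'I_k * 'I_k) 2 ^ lam)).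
  rewrite big_mkcond; apply: leq_prod => ij _; case: ifP => _.
    by rewrite (leq_trans (leq_subr _ _)).
  by rewrite expn_gt0.
by rewrite prod_nat_const card_prod card_ord -expnM mulnC.
Qed.

Lemma separated_of_discr k (m : 'I_k -> nat) p : injective m ->
  prime p -> p \notin primes (discr m) -> p != 2 /\ separated m p.
Proof.
move=> mi pp; rewrite mem_primes pp discr_gt0 /= => np; split.
  by apply: contraNneq np => ->; rewrite dvdn_mulr.
have sep i j : (m i < m j)%N -> m i != m j %[mod p].
  move=> lt; apply: contra np => e.
  have d : (p %| m j - m i)%N by rewrite -eqn_mod_dvd 1?eq_sym // ltnW.
  rewrite /discr; apply: dvdn_mull; rewrite (bigD1 (i, j) lt) /=.
  exact: dvdn_mulr.
move=> i j ij; have : m i != m j by apply: contra ij => /eqP /mi ->.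
by rewrite neq_ltn => /orP[/sep //|/sep]; rewrite eq_sym.
Qed.

Definition sieving_primes (z D : nat) :=
  [seq p <- iota 1 z | prime p && (p \notin primes D)].

(** Euler's product over all primes up to 2^l is at most 1 / (1 + l/2).  The prime
    factors of D are few, and a product of few factors 1 - 1/p is not small. *)
Lemma mertens_sieving l D :
  \prod_(p <- sieving_primes (2 ^ l) D) (1 - p%:R^-1) * (1 + l%:R / 2)
    <= (size (primes D)).+1%:R :> rat.
Proof.
pose z := (2 ^ l)%N; pose bad := [seq p <- iota 1 z | prime p && (p \in primes D)].
pose all_p := [seq p <- iota 1 z | prime p].
have ba : (size bad <= size (primes D))%N.
  apply: uniq_leq_size; first by rewrite filter_uniq ?iota_uniq.
  by move=> p; rewrite mem_filter => /andP[/andP[]].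
have bge : (size bad).+1%:R^-1 <= \prod_(p <- bad) (1 - p%:R^-1) :> rat.
  apply: prod_inv_ge; first by rewrite filter_uniq ?iota_uniq.
  by apply/allP => p; rewrite mem_filter => /andP[/andP[/prime_gt1]].
have spl : \prod_(p <- all_p) (1 - p%:R^-1) =
    \prod_(p <- bad) (1 - p%:R^-1) * \prod_(p <- sieving_primes z D) (1 - p%:R^-1) :> rat.
  by rewrite !big_filter (bigID (fun p => p \in primes D)).
have S0 : 0 <= \prod_(p <- sieving_primes z D) (1 - p%:R^-1) :> rat.
  rewrite big_seq prodr_ge0 // => p; rewrite mem_filter => /andP[/andP[pp _] _].
  by rewrite subr_ge0 invf_le1 ?ltr0n ?ler1n prime_gt0.
have eu : \prod_(p <- all_p) (1 - p%:R^-1) * (1 + l%:R / 2) <= 1 :> rat.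
  have := @euler_product all_p z (filter_all _ _); apply: le_trans.
  apply: ler_wpM2l.
    rewrite big_seq prodr_ge0 // => p; rewrite mem_filter => /andP[pp _].
    by rewrite subr_ge0 invf_le1 ?ltr0n ?ler1n prime_gt0.
  apply: le_trans (harmonic_exp2 l) _.
  rewrite -(big_mkord (fun n => (0 < n)%N && all (mem all_p) (primes n)) (fun n => n%:R^-1)).
  rewrite [leRHS]big_mkcond [leRHS]big_ltn //= add0r.
  apply: ler_sum_nat => n /andP[n0 nz]; rewrite n0 ifT //=.
  apply/allP => p; rewrite mem_primes => /and3P[pp _ pn].
  by rewrite /= mem_filter pp mem_iota prime_gt0 //= add1n (leq_ltn_trans (dvdn_leq _ pn)).
rewrite -/z; set S := \prod_(p <- sieving_primes _ _) _ in spl S0 *.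
have L0 : 0 <= S * (1 + l%:R / 2) by rewrite mulr_ge0 // addr_ge0 // divr_ge0.
have b0 : 0 < (size bad).+1%:R :> rat by rewrite ltr0n.
apply: (@le_trans _ _ (size bad).+1%:R); last by rewrite ler_nat.
rewrite -[leRHS]mul1r -ler_pdivrMr //; apply: le_trans eu.
by rewrite spl mulrC -mulrA ler_wpM2r.
Qed.

Lemma prod_1D_inv (P : seq nat) z : uniq P -> {subset P <= iota 1 z} ->
  \prod_(p <- P) (1 + p%:R^-1) <= z.+1%:R :> rat.
Proof.
move=> uP sP.
have -> : z.+1%:R = \prod_(p <- iota 1 z) (1 + p%:R^-1) :> rat.
  elim: z {sP} => [|z IH]; first by rewrite big_nil.
  have := iotaD 1 z 1; rewrite addn1 add1n => ->.
  rewrite big_cat /= -IH big_seq1 -[z.+2%:R]natr1.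
  by rewrite mulrDr mulr1 mulfV ?pnatr_eq0.
have pE : perm_eq P [seq p <- iota 1 z | p \in P].
  apply: uniq_perm; rewrite ?filter_uniq ?iota_uniq // => p.
  by rewrite mem_filter; case pP: (p \in P) => //=; rewrite sP.
rewrite (perm_big _ pE) big_filter big_mkcond /=.
apply: ler_prod => p _; case: ifP => _.
  by rewrite lexx andbT addr_ge0 // invr_ge0.
by rewrite ler01 lerDl invr_ge0 ler0n.
Qed.

(** The depth 2 s = 4 k (l + 1) of the sieve is chosen such that 2^(-2 s) beats the
    product of the 1 + 2 k/p, which is at most 2^(2 k (l + 1)). *)
Lemma sieve_upper_bound k (m : 'I_k -> nat) lam l X : injective m ->
  (forall i, m i <= 2 ^ lam)%N ->
  (\sum_(0 <= x < X | all (fun p => hits m p x == 0%N)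
                         (sieving_primes (2 ^ l) (discr m))) 1)%:R <=
  X%:R * (((k * k * lam).+2%:R / (1 + l%:R / 2)) ^+ k + 2^-1 ^+ (2 * k * l.+1))
    + (2 ^ ((k + l) * (4 * k * l.+1)))%:R :> rat.
Proof.
move=> mi hm; set P := sieving_primes _ _.
have PP p : p \in P -> [/\ prime p, separated m p & p \in iota 1 (2 ^ l)].
  rewrite mem_filter => /andP[/andP[pp np] pz]; split=> //.
  by have [] := separated_of_discr mi pp np.
have uP : uniq P by rewrite filter_uniq ?iota_uniq.
have aP : all prime P by apply/allP => p /PP[].
have pr (p : nat) : p \in P -> 0 < (p%:R^-1 : rat) <= 1.
  by move=> /PP[pp _ _]; rewrite invr_gt0 invf_le1 ?ltr0n ?ler1n prime_gt0.
have L0 : 0 < 1 + l%:R / 2 :> rat by rewrite ltr_pwDl // divr_ge0.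
apply: le_trans (@brun_sieve k m X (2 * k * l.+1) P uP aP _) _.
  by move=> p /PP[].
apply: lerD; last first.
  have -> : (2 * (2 * k * l.+1) = 4 * k * l.+1)%N by ring.
  rewrite ler_nat [leqRHS]expnM; apply: exp_homo.
  apply: (@leq_trans (1 + k * 2 ^ l)).
    by rewrite leq_add2l leq_mul2l -[X in (_ <= X)%N](size_iota 1) size_filter count_size orbT.
  rewrite expnD; have := ltn_expl k (isT : 1 < 2)%N; have : (0 < 2 ^ l)%N by rewrite expn_gt0.
  nia.
apply: ler_wpM2l => //; apply: lerD.
  apply: (@le_trans _ _ ((\prod_(p <- P) (1 - p%:R^-1)) ^+ k)).
    rewrite -prodrXl big_seq [leRHS]big_seq; apply: ler_prod => p pP.
    have /andP[p0 p1] := pr p pP; have [pp sep _] := PP p pP.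
    rewrite subr_ge0 ler_pdivrMr ?ltr0n ?prime_gt0 // mul1r ler_nat.
    rewrite (separated_leq (prime_gt0 pp) sep) /=.
    by have := @bernoulli rat (- p%:R^-1) k; rewrite mulrN => -> //; rewrite lerN2.
  have S0 : 0 <= \prod_(p <- P) (1 - p%:R^-1) :> rat.
    by rewrite big_seq prodr_ge0 // => p /pr /andP[_]; rewrite subr_ge0.
  have R0 : 0 <= (k * k * lam).+2%:R / (1 + l%:R / 2) :> rat by rewrite divr_ge0 // ltW.
  rewrite lerXn2r ?nnegrE // ler_pdivlMr //; apply: le_trans (mertens_sieving l _) _.
  by rewrite ler_nat ltnS size_primes_discr.
have hW : \prod_(p <- P) (1 + 2 * (k%:R / p%:R)) <= 2 ^+ (l.+1 * (2 * k)) :> rat.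
  apply: (@le_trans _ _ ((\prod_(p <- P) (1 + p%:R^-1)) ^+ (2 * k))).
    rewrite -prodrXl big_seq [leRHS]big_seq; apply: ler_prod => p pP.
    have /andP[p0 p1] := pr p pP.
    rewrite addr_ge0 ?mulr_ge0 ?(ltW p0) ?ler0n //=.
    have := @bernoulli rat (p%:R^-1) (2 * k); rewrite natrM -mulrA; apply; lra.
  rewrite [leRHS]exprM lerXn2r ?nnegrE ?exprn_ge0 //.
    by rewrite big_seq prodr_ge0 // => p /pr /andP[p0 _]; lra.
  apply: le_trans (@prod_1D_inv P (2 ^ l) uP _) _; first by move=> p /PP[].
  rewrite -natrX ler_nat expnS mul2n -addnn -addn1 leq_add2l expn_gt0 //.
apply: le_trans (ler_wpM2l _ hW) _; first by rewrite exprn_ge0 // invr_ge0.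
have -> : (2 * (2 * k * l.+1) = 2 * k * l.+1 + l.+1 * (2 * k))%N by ring.
by rewrite exprD -mulrA -exprMn mulVf // expr1n mulr1.
Qed.

(** * Totients congruent to 2 modulo 4 *)

Local Open Scope nat_scope.

Lemma odd_prime_even_totient p j m : prime p -> p != 2 -> 0 < j -> coprime p m ->
  2 * totient m %| totient (m * p ^ j).
Proof.
move=> pp p2 j0 cpm; rewrite totient_coprime; last by rewrite coprimeXr // coprime_sym.
rewrite mulnC dvdn_mul // totient_pfactor // dvdn_mulr // -subn1 dvdn2 oddB ?prime_gt0 //.
by have [e|] := even_prime pp; [rewrite e in p2|move=> ->].
Qed.

Lemma even_totient m : 2 < m -> 2 %| totient m.
Proof.
move=> m2; have m0 : 0 < m by lia.
have [m' cm e] := pfactor_coprime (isT : prime 2) m0.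
have [m1|m1] := leqP m' 1.
  have m'0 : 0 < m' by move: m0; rewrite e muln_gt0 => /andP[].
  have {m1 m'0} m1 : m' = 1 by lia.
  move: e m2; rewrite m1 mul1n; case: (logn 2 m) => [|[|i]] -> // _.
  by rewrite totient_pfactor // mul1n /= expnS dvdn_mulr.
have pp := pdiv_prime m1; have pm := pdiv_dvd m'; set p := pdiv m' in pp pm.
have p2 : p != 2.
  apply: contraTneq cm => p2; rewrite p2 in pm; rewrite prime_coprime //.
  by rewrite pm.
have {}pm : p %| m by rewrite e dvdn_mulr.
have l0 : 0 < logn p m by rewrite logn_gt0 mem_primes pp m0.
have [m'' cm' e'] := pfactor_coprime pp m0.
rewrite e'; apply: dvdn_trans (odd_prime_even_totient pp p2 l0 cm').
exact: dvdn_mulr.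
Qed.

(** An odd prime power p^j contributes an even factor to the totient, and so does
    a cofactor greater than 2. *)
Lemma totient_mod4_prime_power p n : prime p -> p != 2 -> 0 < n -> p %| n ->
  ~~ (4 %| totient n) -> exists j c, ((c == 1) || (c == 2)) /\ n = c * p ^ j.
Proof.
move=> pp p2 n0 pn n4; have [m cm e] := pfactor_coprime pp n0.
exists (logn p n), m; split=> //.
have m0 : 0 < m by move: n0; rewrite e muln_gt0 => /andP[].
have [m2|m2] := leqP m 2; first by lia.
case/negP: n4; have h : 0 < logn p n by rewrite logn_gt0 mem_primes pp n0.
rewrite e; apply: dvdn_trans (odd_prime_even_totient pp p2 h cm).
by rewrite (dvdn_pmul2l (p := 2) (d := 2)) // even_totient.
Qed.

(** If x + m i has totient 2 modulo 4 and is divisible by an odd prime p <= 2^l, then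
    it is p^j or 2 p^j.  Few numbers are of this form, so up to few exceptions x
    survives the sieve. *)
Lemma count_two_mod4 k (m : 'I_k -> nat) lam l I : injective m ->
  (forall i, 0 < m i <= 2 ^ lam) -> lam <= I ->
  \sum_(0 <= x < 2 ^ I | [forall i, totient (x + m i) %% 4 == 2]) 1 <=
  \sum_(0 <= x < 2 ^ I | all (fun p => hits m p x == 0)
                             (sieving_primes (2 ^ l) (discr m))) 1
   + k * (2 * (2 ^ l * I.+1)).
Proof.
move=> mi hm lamI; set P := sieving_primes _ _.
pose vals := [seq c * v | c <- [:: 1; 2], v <- [seq p ^ j | p <- iota 1 (2 ^ l), j <- iota 0 I.+1]].
pose exc := [seq v - m i | i <- enum 'I_k, v <- vals].
have se : size exc = k * (2 * (2 ^ l * I.+1)).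
  by rewrite /exc /vals !size_allpairs !size_iota -cardE card_ord.
rewrite -se.
apply: (@leq_trans (\sum_(0 <= x < 2 ^ I | all (fun p => hits m p x == 0) P) 1
        + \sum_(0 <= x < 2 ^ I | x \in exc) 1)); last first.
  rewrite leq_add2l sum1_count -size_filter; apply: uniq_leq_size.
    by rewrite filter_uniq ?iota_uniq.
  by move=> x; rewrite mem_filter => /andP[].
rewrite big_mkcond [X in _ <= X + _]big_mkcond [X in _ <= _ + X]big_mkcond -big_split /=.
rewrite big_nat [X in _ <= X]big_nat; apply: leq_sum => x xX.
case: ifP => // /forallP hx; case: ifP => // /negbT/allPn [p pP hp].
rewrite ifT //.
have [i pi] : exists i, p %| x + m i.
  apply/existsP; apply: contraNT hp; rewrite negb_exists => /forallP no.
  by rewrite /hits big1 // => i _; rewrite (negbTE (no i)).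
have /andP[m0 mM] := hm i.
move: pP; rewrite mem_filter => /andP[/andP[pp np] pz].
have [p2 _] := separated_of_discr mi pp np.
have n0 : 0 < x + m i by rewrite addn_gt0 m0 orbT.
have n4 : ~~ (4 %| totient (x + m i)) by rewrite /dvdn (eqP (hx i)).
have [j [c [hc e]]] := totient_mod4_prime_power pp p2 n0 pi n4.
have jI : j < I.+1.
  rewrite -(ltn_exp2l _ _ (isT : 1 < 2)).
  apply: (@leq_ltn_trans (x + m i)).
    rewrite e; apply: (@leq_trans (p ^ j)); last by rewrite leq_pmull //; case/orP: hc => /eqP ->.
    by apply: exp_homo; apply: prime_gt1.
  have : 2 ^ lam <= 2 ^ I by rewrite leq_exp2l.
  by move: xX; rewrite expnS; lia.
have -> : x = (x + m i) - m i by rewrite addnK.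
rewrite /exc; apply: (allpairs_f (fun i v => v - m i)); first by rewrite mem_enum.
rewrite e; apply: (allpairs_f (fun c v => c * v)); first by rewrite !inE.
by apply: (allpairs_f (fun p j => p ^ j)) => //; rewrite mem_iota.
Qed.

(** Each shift m contributes about as many primes as there are up to X, so the
    windows contain on average at least (N + 1)/I^2 = 4 k of them; the windows with
    fewer than k of them account for at most a quarter of this. *)
Lemma many_rich_windows d k N I :
  let X := 2 ^ I in let rich x := \sum_(m < N.+1) prime_ne1 d (x.+1 + m) in
  X <= I ^ 2 * count_primes_ne1 d X -> N.+1 = 4 * k * I ^ 2 -> 4 * I ^ 2 * N.+1 <= X ->
  X <= 2 * I ^ 2 * \sum_(0 <= x < X | k <= rich x) 1.
Proof.
move=> X W hX hN hNX; set G := \sum_(_ <= _ < _ | _) _.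
have hm (m : 'I_N.+1) :
    count_primes_ne1 d X <= N.+1 + \sum_(0 <= x < X) prime_ne1 d (x.+1 + m).
  rewrite /count_primes_ne1 big_mkcond.
  under eq_bigr => p _ do (have -> : (if prime_ne1 d p then 1 else 0) = prime_ne1 d p :> nat
    by case: ifP).
  have mX : m.+1 <= X.+1 by have := ltn_ord m; nia.
  rewrite (big_cat_nat (n := m.+1)) //=; apply: leq_add.
    apply: (@leq_trans (\sum_(0 <= p < m.+1) 1)); first by apply: leq_sum => p _; case: prime_ne1.
    by rewrite sum_nat_const_nat subn0 muln1 ltn_ord.
  rewrite -[X in \sum_(X <= _ < _) _]add0n big_addn subSS.
  have -> : \sum_(0 <= i < X - m) prime_ne1 d (i + m.+1) =
            \sum_(0 <= i < X - m) prime_ne1 d (i.+1 + m).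
    by apply: eq_bigr => i _; rewrite addnS addSn.
  by rewrite [X in _ <= X](big_cat_nat (n := X - m)) //= ?leq_subr // leq_addr.
have h1 : N.+1 * count_primes_ne1 d X <= N.+1 * N.+1 + \sum_(0 <= x < X) W x.
  rewrite /W exchange_big /=.
  have -> : N.+1 * count_primes_ne1 d X = \sum_(m < N.+1) count_primes_ne1 d X.
    by rewrite sum_nat_const card_ord.
  have -> : N.+1 * N.+1 = \sum_(m < N.+1) N.+1 by rewrite sum_nat_const card_ord.
  by rewrite -big_split; apply: leq_sum => m _; apply: hm.
have h2 : \sum_(0 <= x < X) W x <= N.+1 * G + k * X.
  have -> : k * X = \sum_(0 <= x < X) k by rewrite sum_nat_const_nat subn0 mulnC.
  rewrite /G big_distrr [X in _ <= X + _]big_mkcond -big_split /=.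
  apply: leq_sum => x _; case: (leqP k (W x)) => [_|/ltnW //].
  rewrite muln1; apply: leq_trans (leq_addr _ _).
  have -> : N.+1 = \sum_(m < N.+1) 1 by rewrite sum_nat_const card_ord muln1.
  by apply: leq_sum => m _; case: prime_ne1.
set cnt := count_primes_ne1 d X in hX h1.
have h3 : N.+1 * X <= I ^ 2 * (N.+1 * N.+1 + (N.+1 * G + k * X)).
  apply: leq_trans (leq_mul (leqnn _) hX) _.
  by rewrite mulnCA leq_mul2l (leq_trans h1) ?orbT // leq_add2l.
have h4 : 4 * (I ^ 2 * (k * X)) = N.+1 * X by rewrite hN; ring.
have h5 : 4 * (I ^ 2 * (N.+1 * N.+1)) <= N.+1 * X.
  have -> : 4 * (I ^ 2 * (N.+1 * N.+1)) = N.+1 * (4 * I ^ 2 * N.+1) by ring.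
  by rewrite leq_mul2l hNX orbT.
rewrite -(leq_pmul2l (ltn0Sn N)).
have -> : N.+1 * (2 * I ^ 2 * G) = 2 * (I ^ 2 * (N.+1 * G)) by ring.
move: h3 h4 h5; rewrite !mulnDr.
set a := I ^ 2 * (N.+1 * N.+1); set b := I ^ 2 * (N.+1 * G); set c := I ^ 2 * (k * X).
set e := N.+1 * X; lia.
Qed.

Lemma popular_class (K : finType) (kap : nat -> K) (Q : pred nat) X :
  exists t, \sum_(0 <= x < X | Q x) 1 <= #|K| * \sum_(0 <= x < X | Q x && (kap x == t)) 1.
Proof.
pose F t := \sum_(0 <= x < X | Q x && (kap x == t)) 1.
have [t _ tmax] := @arg_maxnP K (kap 0) xpredT F isT.
exists t; rewrite (partition_big kap xpredT) //= -sum_nat_const.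
by apply: leq_sum => t' _; apply: tmax.
Qed.

(** Logarithms to base 2 of the quantities compared in the end.  The number of
    classes times 2 I^2 is at most 2^(e - 3), and e grows like h k / 2 by the
    choice of k, whereas the sieve saves 2^((h - 1) k). *)
Lemma sieve_exponents C k h I : k = 24 * C.+1 -> k + 20 <= h -> 2 ^ (6 * h) <= I ->
  let e := (12 * h + 15 + k) * C.+1 + 3 in let l := 2 ^ (2 * h) in
  [/\ e <= h.-1 * k, e <= 2 * k * l.+1, e + (k + l) * (4 * k * l.+1) <= I,
      e + (k + 1 + l + (6 * h + 6)) <= I & 12 * h + 14 + k <= I].
Proof.
move=> kE hk hI e l.
have e1 : e <= h.-1 * k by rewrite /e kE in hk *; nia.
have lh : h ^ 2 < l by rewrite /l mulnC expnM ltn_sqr ltn_expl.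
have l3 : l ^ 3 <= I by apply: leq_trans hI; rewrite /l -expnM; have -> : 2 * h * 3 = 6 * h by ring.
have k0 : 0 < k by rewrite kE.
rewrite !expnS expn0 !muln1 in l3 lh.
clearbody e l.
have lk : 40 * k <= l by nia.
have hl : h <= l by nia.
have e2 : e <= k * l by nia.
have lk2 : k * l * 40 <= l * l by nia.
have ll : 40 * l <= l * l by nia.
have ll3 : 40 * (l * l) <= l * (l * l) by nia.
have kll : 40 * (k * (l * l)) <= l * (l * l) by nia.
split; [by []|nia| |lia|lia].
have h1 : k + l <= 2 * l by lia.
have h2 : 4 * k * l.+1 <= 8 * (k * l) by nia.
have := leq_mul h1 h2.
have -> : 2 * l * (8 * (k * l)) = 16 * (k * (l * l)) by ring.
by move=> h3; apply: leq_trans l3; apply: leq_trans (leq_add e2 h3) _; lia.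
Qed.

Local Open Scope ring_scope.

(** Each of the four contributions to Phi * (S + E2) is at most X/8. *)
Lemma sieve_beats_classes (Phi X S E1 E2 h l q k : nat) (A : rat) :
  (0 < X)%N -> (X <= Phi * (S + E2))%N ->
  S%:R <= X%:R * (A ^+ k + 2^-1 ^+ q) + E1%:R ->
  0 <= A <= 2^-1 ^+ h ->
  (8 * Phi <= 2 ^ (h * k))%N -> (8 * Phi <= 2 ^ q)%N ->
  (8 * (Phi * E1) <= X)%N -> (8 * (Phi * E2) <= X)%N -> False.
Proof.
move=> X0 hX hS /andP[A0 A1] f1 f2 f3 f4.
have P2 n : (8 * Phi <= 2 ^ n)%N -> Phi%:R * 2^-1 ^+ n <= 1 / 8 :> rat.
  rewrite -(ler_nat rat) natrX natrM => f.
  have p0 : 0 < 2 ^+ n :> rat by rewrite exprn_gt0.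
  rewrite exprVn ler_pdivrMr; [lra|exact: p0].
have h1 : Phi%:R * A ^+ k <= 1 / 8.
  apply: le_trans (P2 _ f1); rewrite ler_wpM2l // exprM lerXn2r ?nnegrE //.
  by rewrite exprn_ge0.
have h2 := P2 _ f2.
have X0r : 0 < X%:R :> rat by rewrite ltr0n.
rewrite -(ler_nat rat) !natrM in f3; rewrite -(ler_nat rat) !natrM in f4.
have hX' : X%:R <= Phi%:R * S%:R + Phi%:R * E2%:R :> rat.
  by rewrite -mulrDr -natrD -natrM ler_nat.
have hS' := ler_wpM2l (ler0n rat Phi) hS.
have h1' := ler_wpM2l (ltW X0r) h1; have h2' := ler_wpM2l (ltW X0r) h2.
have e : Phi%:R * (X%:R * (A ^+ k + 2^-1 ^+ q) + E1%:R) =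
  X%:R * (Phi%:R * A ^+ k) + X%:R * (Phi%:R * 2^-1 ^+ q) + Phi%:R * E1%:R by ring.
rewrite e in hS'; lra.
Qed.

Local Open Scope nat_scope.

Lemma totient_prime_ne1_mod4 p : prime_ne1 4 p -> totient p %% 4 = 2.
Proof.
move=> /and3P[pp cp p1]; rewrite totient_prime //.
have p0 := prime_gt0 pp.
have : p %% 4 != 1 by [].
have : odd p by rewrite -coprimen2 (coprime_dvdr _ cp).
lia.
Qed.

(** Some class contains at least 2^I / (2 I^2 #|K|) windows with k primes that are
    3 modulo 4.  At the positions of these primes in one such window, all windows
    of the class have totient 2 modulo 4. *)
Lemma totient_window_bound k n lam l I (K : finType) (kp : nat -> K) C :
  0 < k -> n = 4 * k * I ^ 2 -> 0 < I -> n <= 2 ^ lam -> lam <= I ->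
  4 * I ^ 2 * n <= 2 ^ I ->
  2 ^ I <= I ^ 2 * count_primes_ne1 4 (2 ^ I) ->
  #|K| <= n.+1 ^ C ->
  (forall x y, kp x = kp y -> forall m, m < n ->
     totient (x.+1 + m) = totient (y.+1 + m) %[mod 4]) ->
  exists m : 'I_k -> nat, [/\ injective m, forall i, m i <= 2 ^ lam &
   2 ^ I <= 2 ^ (lam.+1 * C.+1) *
     (\sum_(0 <= x < 2 ^ I | all (fun p => hits m p x == 0)
                             (sieving_primes (2 ^ l) (discr m))) 1
   + k * (2 * (2 ^ l * I.+1)))].
Proof.
move=> k0 nE I0 nlam lamI hn hI cK hK.
have n0 : 0 < n by rewrite nE !muln_gt0 k0 I0.
pose X := 2 ^ I; pose T x (m : 'I_n) := prime_ne1 4 (x.+1 + m).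
pose rich x := k <= \sum_(m < n) T x m.
have := @many_rich_windows 4 k n.-1 I hI; rewrite prednK // => /(_ nE hn) hrich.
have [t ht] := popular_class kp rich X.
pose Gt := \sum_(0 <= x < X | rich x && (kp x == t)) 1.
have XG : X <= 2 ^ (lam.+1 * C.+1) * Gt.
  have c1 : 2 * I ^ 2 <= 2 ^ lam.+1.
    rewrite [2 ^ lam.+1]expnS leq_mul2l /= (leq_trans _ nlam) // nE leq_pmull //.
    by rewrite muln_gt0 k0.
  have c2 : #|K| <= 2 ^ (lam.+1 * C).
    rewrite (leq_trans cK) // expnM exp_homo // [2 ^ lam.+1]expnS mul2n -addnn -[n.+1]addn1.
    by rewrite leq_add ?expn_gt0.
  rewrite mulnS expnD -mulnA; apply: leq_trans hrich (leq_mul c1 _).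
  exact: leq_trans ht (leq_mul c2 (leqnn _)).
have Gt0 : 0 < Gt.
  by move: (leq_trans (expn_gt0 2 I : 0 < X) XG); rewrite muln_gt0 => /andP[].
have [x0 rx0 tx0] : exists2 x0, rich x0 & kp x0 == t.
  move: Gt0; rewrite /Gt sum1_count -has_count => /hasP[x0 _ /andP[? ?]].
  by exists x0.
pose S := [set m : 'I_n | T x0 m]%SET.
have kS : k <= #|S|.
  rewrite (leq_trans rx0) // -sum1dep_card [X in _ <= X]big_mkcond /=.
  by apply: leq_sum => m _; case: (T x0 m).
pose i0 := Ordinal n0.
pose s (i : 'I_k) := nth i0 (enum S) i.
have sS i : s i \in S.
  by rewrite -mem_enum mem_nth // -cardE (leq_trans _ kS).
have si : injective s.
  move=> i j /eqP; rewrite nth_uniq ?enum_uniq // -?cardE ?(leq_trans _ kS) //.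
  by move=> /eqP e; apply: val_inj.
(* Windows start at x + 1. *)
pose m i := (s i).+1.
have mi : injective m by move=> i j [e]; apply/si/val_inj.
have mlam i : 0 < m i <= 2 ^ lam by rewrite /m /= (leq_trans _ nlam).
exists m; split=> [//|i|]; first by have /andP[] := mlam i.
apply: leq_trans XG _; rewrite leq_mul2l; apply/orP; right.
apply: leq_trans (@count_two_mod4 k m lam l I mi mlam lamI).
rewrite /Gt big_mkcond [X in _ <= X]big_mkcond; apply: leq_sum => x _.
case: ifP => // /andP[_ /eqP xt]; rewrite ifT //; apply/forallP => i.
rewrite /m addnS -addSn (hK x x0) ?xt ?(eqP tx0) //.
by apply/eqP/totient_prime_ne1_mod4; have := sS i; rewrite inE.
Qed.

(** The sieve reaches up to 2^l with l about I^(1/3); this keeps its error term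
    below X = 2^I and still saves a power of I for each of the k shifts. *)
Lemma totient_mod4 : ~ poly_complexity (fun n => totient n %% 4).
Proof.
move=> [C hC]; pose k := 24 * C.+1.
(* The bound on k^2 lam + 2, with lam as below, is linear in h. *)
have [h1 hh1] := poly_lt_exp2 (k * k * (26 + k) + 2) 1.
have [n2 hn2] := poly_lt_exp2 (16 * k) 4.
pose H0 := (h1 + k + 20)%N.
have [I leI hI] := many_primes_ne1 (maxn n2 (2 ^ (6 * H0.+1))) (isT : 2 < 4).
have I0 : 0 < I by rewrite (leq_trans _ leI) // leq_max expn_gt0 orbT.
pose h := trunc_log 2 I %/ 6.
have hlo : 2 ^ (6 * h) <= I.
  by apply: leq_trans (trunc_logP (isT : 1 < 2) I0); rewrite leq_exp2l // mulnC leq_divM.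
have hhi : I < 2 ^ (6 * h.+1).
  apply: leq_trans (trunc_log_ltn I (isT : 1 < 2)) _.
  by rewrite leq_exp2l // mulnC ltn_ceil.
have H0h : H0 <= h.
  rewrite -ltnS -(ltn_pmul2l (isT : 0 < 6)) -(ltn_exp2l _ _ (isT : 1 < 2)).
  apply: leq_ltn_trans hhi; rewrite (leq_trans _ leI) // leq_max leq_exp2l //.
  by rewrite leq_mul2l leqnSn !orbT.
have hk : k + 20 <= h by rewrite (leq_trans _ H0h) // /H0 -addnA leq_addl.
have [e1 e2 e3 e4 e5] := @sieve_exponents C k h I erefl hk hlo.
set l := 2 ^ (2 * h) in e2 e3 e4.
pose lam := 12 * h + 14 + k; pose n := 4 * k * I ^ 2.
have k0 : 0 < k by [].
have n0 : 0 < n by rewrite /n muln_gt0 expn_gt0 I0.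
have nlam : n <= 2 ^ lam.
  have -> : lam = 2 + k + 6 * h.+1 * 2 by rewrite /lam; ring.
  rewrite !expnD /n; apply: leq_mul.
    by apply: leq_mul => //; apply/ltnW/ltn_expl.
  by rewrite [leqRHS]expnM exp_homo // ltnW.
have hn : 4 * I ^ 2 * n <= 2 ^ I.
  have -> : 4 * I ^ 2 * n = 16 * k * I ^ 4 by rewrite /n; ring.
  by rewrite ltnW // hn2 // (leq_trans _ leI) // leq_maxl.
have [K [kp [cK hK]]] := hC n.-1.
rewrite prednK // in cK.
have hK' x y : kp (x.+1, 1) = kp (y.+1, 1) -> forall m, m < n ->
     totient (x.+1 + m) = totient (y.+1 + m) %[mod 4].
  move=> e m mn; have := hK (x.+1, 1) (y.+1, 1) isT isT e m.
  by rewrite /= !mul1n; apply; rewrite -ltnS prednK.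
have [m [mi mlam hX]] := @totient_window_bound k n lam l I K _ C
   k0 erefl I0 nlam e5 hn hI cK hK'.
set S := \sum_(_ <= _ < _ | _) _ in hX.
have hS := sieve_upper_bound l (2 ^ I) mi mlam.
apply: (@sieve_beats_classes _ _ _ _ _ h.-1 l (2 * k * l.+1) k _ _ hX hS).
- by rewrite expn_gt0.
- have l0 : (0 < 1 + l%:R / 2 :> rat)%R by rewrite ltr_pwDl // divr_ge0.
  rewrite divr_ge0 ?ler0n ?(ltW l0) //= ler_pdivrMr //.
  have hA : (k * k * lam).+2 <= 2 ^ h.
    have := hh1 h; rewrite expn1 => /(_ _) /ltnW h2.
    apply: leq_trans (h2 _); last by rewrite (leq_trans _ H0h) // /H0 -addnA leq_addr.
    have h0 : 0 < h by rewrite (leq_trans _ hk) // addnS.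
    rewrite -[_.+2]addn2 mulnDl -[k * k * (26 + k) * h]mulnA leq_add ?leq_pmulr //.
    rewrite leq_mul2l mulnDl; apply/orP; right.
    have := leq_pmulr k h0; rewrite /lam; set kh := k * h; lia.
  have hl : 2 ^ h.-1 * 2 ^ h * 2 = l.
    by rewrite -expnD -expnSr /l; congr (2 ^ _); lia.
  apply: (@le_trans _ _ (2 ^ h)%:R%R); first by rewrite ler_nat.
  rewrite -hl natrM mulfK // natrM.
  have -> : (2^-1 ^+ h.-1 = (2 ^ h.-1)%:R^-1 :> rat)%R by rewrite exprVn natrX.
  rewrite mulrDr mulr1 mulKf ?lerDr ?invr_ge0 ?ler0n //.
  by rewrite pnatr_eq0 -lt0n expn_gt0.
- rewrite -[8]/(2 ^ 3) -expnD leq_exp2l //; apply: leq_trans e1.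
  by rewrite /lam addnC; lia.
- rewrite -[8]/(2 ^ 3) -expnD leq_exp2l //; apply: leq_trans e2.
  by rewrite /lam addnC; lia.
- rewrite -[8]/(2 ^ 3) -!expnD leq_exp2l //; apply: leq_trans e3.
  by rewrite /lam; lia.
- rewrite -[8]/(2 ^ 3).
  apply: leq_trans (_ : 2 ^ 3 * (2 ^ (lam.+1 * C.+1) * 2 ^ (k + 1 + l + (6 * h + 6))) <= _).
    rewrite !leq_mul2l /=; apply/orP; right.
    have -> : 2 ^ (k + 1 + l + (6 * h + 6)) = 2 ^ k * (2 * (2 ^ l * 2 ^ (6 * h.+1))).
      by rewrite -(expnD 2 l) -expnS -expnD; congr (2 ^ _); lia.
    apply: leq_mul; first exact/ltnW/ltn_expl.
    by rewrite !leq_mul2l hhi !orbT.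
  rewrite -!expnD leq_exp2l //; apply: leq_trans e4.
  by rewrite /lam; lia.
Qed.

(** * The theorem *)

Local Open Scope ring_scope.

Lemma odd_prime_or_four_dvd q : (3 <= q)%N ->
  (exists r, [/\ prime r, (2 < r)%N & (r %| q)%N]) \/ (4 %| q)%N.
Proof.
move=> hq; have q0 : (0 < q)%N by lia.
have [m cm e] := pfactor_coprime (isT : prime 2) q0.
have [m1|m1] := leqP m 1.
  right; have m0 : (0 < m)%N by move: q0; rewrite e muln_gt0 => /andP[].
  have {m1 m0} m1 : m = 1%N by lia.
  move: e hq; rewrite m1 mul1n; case: (logn 2 q) => [|[|i]] -> // _.
  by rewrite !expnS mulnA dvdn_mulr.
left; exists (pdiv m); have pm := pdiv_dvd m; have pp := pdiv_prime m1.
split=> //; last by rewrite e dvdn_mulr.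
rewrite ltn_neqAle prime_gt1 // andbT; apply: contraTneq cm => p2.
by rewrite prime_coprime // p2 pm.
Qed.

Local Open Scope classical_set_scope.
Local Open Scope ring_scope.

Theorem proposition11p15 (R : realType) (q : nat) (hq : (3 <= q)%N) :
  ~ bracket_word R [set n : nat | (1 <= n)%N]
      (fun n : nat => (totient n)%:R : 'Z_q).
Proof.
move=> /bracket_complexity hC.
have coarse d : (d %| q)%N -> poly_complexity (fun n => totient n %% d)%N.
  move=> dq; apply: poly_complexity_coarsen hC => m n /(congr1 val).
  rewrite /= !val_Zp_nat; [|lia|lia].
  by move=> e; rewrite -(modn_dvdm _ dq) e modn_dvdm.
have [[r [pr r2 rq]]|q4] := odd_prime_or_four_dvd hq.
  exact: totient_mod_odd_prime pr r2 (coarse r rq).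
exact: totient_mod4 (coarse 4%N q4).
Qed.
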